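(* Let $\varphi\in A_\infty(\Omega)\cap\mathbb S^-$ be a Musielak–Orlicz function of uniformly lower type $p_\varphi^-$ and uniformly upper type $p_\varphi^+$ with $1<p_\varphi^-\le p_\varphi^+<\infty$. If the Doob maximal operator $M$ is bounded on $L^{\varphi^*}(\Omega)$, then there is $C>0$ such that for every martingale $f\in\mathcal M$, $$C^{-1}\|S(f)\|_{L^\varphi(\Omega)}\le\|M(f)\|_{L^\varphi(\Omega)}\le C\|S(f)\|_{L^\varphi(\Omega)}.$$
   Context: Let $(\Omega,\mathcal F,\mathbb P)$ be a probability space, $(\mathcal F_n)_{n\in\mathbb Z_+}$ a nondecreasing sequence of sub-$\sigma$-algebras, $\mathbb E_n$ the conditional expectations, $M(g):=\sup_n|\mathbb E_ng|$ and for a martingale $M(f):=\sup_n|f_n|$. A Musielak–Orlicz function is $\varphi:\Omega\times[0,\infty)\to[0,\infty)$ with $\varphi(x,\cdot)$ nondecreasing, $\varphi(x,0)=0$, $\lim_{t\to\infty}\varphi(x,t)=\infty$ for each $x$, $\varphi(\cdot,t)$ measurable, positive, integrable; $\varphi_n(\cdot,t):=\mathbb E_n\varphi(\cdot,t)$; $\|g\|_{L^\varphi}:=\inf\{\lambda>0:\int_\Omega\varphi(x,|g|/\lambda)\,d\mathbb P\le1\}$ (same for $\varphi^*$). Uniformly lower (upper) type $p$: $\varphi(x,st)\le Cs^p\varphi(x,t)$ for $s\in(0,1)$ (resp. $s\ge1$). $\varphi\in A_q$ ($q>1$): $\sup_{t>0}\varphi_n(\cdot,t)[\mathbb E_n(\varphi(\cdot,t)^{-1/(q-1)})]^{q-1}\le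 K$ a.e. for all $n$; $A_1$: $\sup_t\varphi_n(\cdot,t)/\varphi(\cdot,t)\le K$; $A_\infty=\bigcup_{q\ge1}A_q$. $\varphi\in\mathbb S^-$: $K^{-1}\varphi_{n-1}(x,t)\le\varphi_n(x,t)$ for all $t$, $n\ge1$, a.e. $x$. $\varphi^*(x,t):=\sup_{u>0}[ut-\varphi(x,u)]$. $\mathcal M$: martingales with $f_0=0$; $S(f):=(\sum_{n\ge1}|f_n-f_{n-1}|^2)^{1/2}$. *)

(* Defs.v *)
From HB Require Import structures.
From mathcomp Require Import all_boot all_order all_algebra.
From mathcomp Require Import all_classical all_reals all_analysis measurable_realfun.
Set Implicit Arguments. Unset Strict Implicit. Unset Printing Implicit Defensive.
Import Order.TTheory GRing.Theory Num.Theory.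
Import numFieldNormedType.Exports.
Local Open Scope classical_set_scope.
Local Open Scope ring_scope.

Section MO.
Context {d : measure_display} {T : measurableType d} {R : realType}.
Variable P : probability T R.

Definition filtration (F : nat -> set (set T)) : Prop :=
  [/\ forall n, sigma_algebra setT (F n),
      forall n, F n `<=` measurable
    & forall n m, (n <= m)%N -> F n `<=` F m].

Definition G_meas (G : set (set T)) (g : T -> R) : Prop :=
  forall B : set R, measurable B -> G (g @^-1` B).
Definition G_measE (G : set (set T)) (g : T -> \bar R) : Prop :=
  forall B : set (\bar R), measurable B -> G (g @^-1` B).

Definition cexp_version (G : set (set T)) (f g : T -> R) : Prop :=
  [/\ P.-integrable setT (EFin \o f), G_meas G g,
      P.-integrable setT (EFin \o g)
    & forall A, G A -> (\int[P]_(x in A) (g x)%:E = \int[P]_(x in A) (f x)%:E)%E].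

Definition cexp_version_nneg (G : set (set T)) (f : T -> R) (g : T -> \bar R) : Prop :=
  [/\ G_measE G g, (forall x, 0 <= g x)%E
    & forall A, G A -> (\int[P]_(x in A) g x = \int[P]_(x in A) (f x)%:E)%E].

(** Musielak--Orlicz function (phi is only relevant on t >= 0). *)
Definition MO_function (phi : T -> R -> R) : Prop :=
  (forall x s t, 0 <= s -> s <= t -> phi x s <= phi x t) /\
  [/\ forall x, phi x 0 = 0,
      forall x, phi x t @[t --> +oo%R] --> +oo%R,
      forall t, 0 <= t -> measurable_fun setT (phi^~ t),
      forall x t, 0 < t -> 0 < phi x t
    & forall t, 0 <= t -> P.-integrable setT (EFin \o phi^~ t)].

Definition unif_lower_type (phi : T -> R -> R) (p : R) : Prop :=
  exists C : R, 0 < C /\ forall x s t, 0 < s -> s < 1 -> 0 <= t ->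
    phi x (s * t) <= C * s `^ p * phi x t.

Definition unif_upper_type (phi : T -> R -> R) (p : R) : Prop :=
  exists C : R, 0 < C /\ forall x s t, 1 <= s -> 0 <= t ->
    phi x (s * t) <= C * s `^ p * phi x t.

Definition Aq (F : nat -> set (set T)) (phi : T -> R -> R) (q : R) : Prop :=
  exists K : R, forall n t, 0 < t ->
    forall (a : T -> R) (b : T -> \bar R),
      cexp_version (F n) (phi^~ t) a ->
      cexp_version_nneg (F n) (fun x => (phi x t) `^ (- (q - 1)^-1)) b ->
      {ae P, forall x, ((a x)%:E * poweR (b x) (q - 1) <= K%:E)%E}.

Definition A1 (F : nat -> set (set T)) (phi : T -> R -> R) : Prop :=
  exists K : R, forall n t, 0 < t -> forall a : T -> R,
      cexp_version (F n) (phi^~ t) a ->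
      {ae P, forall x, a x / phi x t <= K}.

Definition Ainfty (F : nat -> set (set T)) (phi : T -> R -> R) : Prop :=
  A1 F phi \/ exists q : R, 1 < q /\ Aq F phi q.

Definition Sminus (F : nat -> set (set T)) (phi : T -> R -> R) : Prop :=
  exists K : R, 0 < K /\ forall n t, (1 <= n)%N -> 0 <= t ->
    forall a b : T -> R,
      cexp_version (F n.-1) (phi^~ t) a -> cexp_version (F n) (phi^~ t) b ->
      {ae P, forall x, K^-1 * a x <= b x}.

Definition conj_fun (phi : T -> R -> R) : T -> R -> \bar R :=
  fun x t => ereal_sup [set (u * t - phi x u)%:E | u in [set u : R | 0 < u]].

(** Extend Phi(x,.) to \bar R arguments (only nonnegative ones occur). *)
Definition Phi_ext (Phi : T -> R -> \bar R) (x : T) (y : \bar R) : \bar R :=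
  match y with r%:E => Phi x r | _ => +oo%E end.

Definition lux (Phi : T -> R -> \bar R) (g : T -> \bar R) : \bar R :=
  ereal_inf [set l%:E | l in [set l : R | 0 < l /\
     (\int[P]_x Phi_ext Phi x (`|g x| * (l^-1)%:E) <= 1)%E]].

Definition luxR (phi : T -> R -> R) (g : T -> \bar R) : \bar R :=
  lux (fun x t => (phi x t)%:E) g.

Definition maxf (h : nat -> T -> R) : T -> \bar R :=
  fun x => ereal_sup (range (fun n => (`|h n x|)%:E)).

Definition sqf (f : nat -> T -> R) : T -> \bar R :=
  fun x => let s := (\sum_(1 <= n <oo) ((f n x - f n.-1 x) ^+ 2)%:E)%E in
           if s is r%:E then (Num.sqrt r)%:E else +oo%E.

Definition martingale0 (F : nat -> set (set T)) (f : nat -> T -> R) : Prop :=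
  [/\ {ae P, forall x, f 0%N x = 0},
      forall n, G_meas (F n) (f n),
      forall n, P.-integrable setT (EFin \o f n)
    & forall n, cexp_version (F n) (f n.+1) (f n)].

Definition doob_bounded (F : nat -> set (set T)) (Phi : T -> R -> \bar R) : Prop :=
  exists C : R, 0 < C /\ forall g : T -> R, measurable_fun setT g ->
    (lux Phi (EFin \o g) < +oo)%E ->
    forall h : nat -> T -> R, (forall n, cexp_version (F n) g (h n)) ->
      (lux Phi (maxf h) <= C%:E * lux Phi (EFin \o g))%E.

End MO.

(* Main.v *)
(* Both inequalities come from weighted versions of Davis' inequality for a
   bounded weight w >= 0, with w_n = E_n w and running maxima
   f*_n = max_(k <= n) |f_k|, w*_n = max_(k <= n) w_k:
     E[S_n(f) w] <= 4 E[f*_n w*_n]   and   E[f*_n w] <= 6 E[S_n(f) w*_n].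
   Choosing w close to phi(x, t) / t, where t is a simple function below
   X / mu (X being S(f) or M(f)), gives phi^*(x, w) <= t w, so boundedness of M
   on L^(phi^* ) controls M(w), and Young's inequality turns the weighted
   estimate into an inequality between Luxemburg norms.
   The first weighted inequality telescopes the potential
   w*_n (f_n^2 / f*_n + 2 f*_n), as in Zorin-Kranich's proof of Davis'
   inequality.  For the second one, write f*_N = sum_k theta_k f_k with
   sum_k |theta_k| <= 1; then E[f*_N w] = sum_j E[d_j (g_j - q_(j-1))] for
   g_j = E_j[w sum_(k >= j) theta_k] and q_(j-1) = E_(j-1)[w sum_(k >= j) theta_k],
   and the potential S_n (g_n^2 / w*_n + 2 w*_n) controls the increments
   g_j - q_(j-1) exactly as in the first case, the roles of (f, f*, w*_n) being
   played by (g, w*_n, S). *)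
Require Import Defs.
From HB Require Import structures.
From mathcomp Require Import all_boot all_order all_algebra.
From mathcomp Require Import all_classical all_reals all_analysis measurable_realfun.
From mathcomp Require Import ring lra.
Import Order.TTheory GRing.Theory Num.Theory.
Import numFieldNormedType.Exports.
Local Open Scope classical_set_scope.
Local Open Scope ring_scope.
Set Implicit Arguments.
Unset Strict Implicit.
Unset Printing Implicit Defensive.

(** One step of the potential [x ^+ 2 / m + 2 * m]. For a fixed weight, its increment minus the part
    linear in [x' - x] exceeds [(x' - x) ^+ 2 / m'] by [(m^-1 - m'^-1) * (x ^+ 2 - 2 * x * x' + 2 *
    m * m')], which is nonnegative since [|x * x'| <= m * m']. A growing weight adds [v' - v] times
    the new potential; the outer factor 2 makes this cover the jump. *)
Lemma davis_step (R : realFieldType) (x x' m m' v v' : R) :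
  `|x| <= m -> `|x'| <= m' -> m <= m' -> 0 <= v -> v <= v' ->
  v' * ((x' - x) ^+ 2 / m') <=
  2 * (v' * (x' ^+ 2 / m' + 2 * m') - v * (x ^+ 2 / m + 2 * m)
       - 2 * (v * (x / m) * (x' - x))).
Proof.
move=> xm x'm' mm' v0 vv'.
have m0 : 0 <= m by apply: le_trans xm.
have m'0 : 0 <= m' by apply: le_trans mm'.
have sq (y k : R) : `|y| <= k -> y ^+ 2 <= k ^+ 2.
  by move=> yk; rewrite -real_normK ?num_real// lerXn2r// ?nnegrE// (le_trans _ yk).
have x2 := sq _ _ xm; have x'2 := sq _ _ x'm'.
have key : (x' - x) ^+ 2 / m' <=
    x' ^+ 2 / m' + 2 * m' - (x ^+ 2 / m + 2 * m) - 2 * ((x / m) * (x' - x)).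
  (* A vanishing [m] or [m'] is treated separately: there the quotient is 0 by convention, whereas
     the identity below needs both to be invertible. *)
  move: m'0; rewrite le_eqVlt => /predU1P[m'E|m'p].
    have mE : m = 0 by apply/eqP; rewrite eq_le m0 m'E mm'.
    by rewrite -m'E mE !invr0 !(mulr0, mul0r, subr0, addr0).
  move: m0; rewrite le_eqVlt => /predU1P[mE|mp].
    have -> : x = 0 by apply/normr0_eq0/eqP; rewrite eq_le normr_ge0 mE xm.
    by rewrite !(expr0n, mul0r, subr0, mulr0)/= -mE; lra.
  have xx' : - (2 * m * m') <= - (2 * (x * x')).
    rewrite lerN2 -mulrA ler_pM2l// (le_trans (ler_norm _))// normrM.
    exact: ler_pM.
  have -> : x' ^+ 2 / m' + 2 * m' - (x ^+ 2 / m + 2 * m) - 2 * ((x / m) * (x' - x))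
     = (x' - x) ^+ 2 / m' +
       (m^-1 - m'^-1) * (x ^+ 2 - 2 * (x * x') + 2 * m * m').
    by field; rewrite !gt_eqF.
  rewrite lerDl mulr_ge0// ?subr_ge0 ?lef_pV2//.
  by rewrite -addrA addr_ge0 ?sqr_ge0//; lra.
have jump : (x' - x) ^+ 2 / m' <= 2 * (x' ^+ 2 / m' + 2 * m').
  move: m'0; rewrite le_eqVlt => /predU1P[<-|m'p].
    by rewrite !invr0 !mulr0 addr0 mulr0.
  rewrite ler_pdivrMr//.
  have -> : 2 * (x' ^+ 2 / m' + 2 * m') * m' = 2 * x' ^+ 2 + 4 * m' ^+ 2.
    by field; rewrite gt_eqF.
  have : x ^+ 2 <= m' ^+ 2 by rewrite (le_trans x2)// lerXn2r ?nnegrE// ltW.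
  have : 0 <= (x + x') ^+ 2 by exact: sqr_ge0.
  by move: (sqr_ge0 m'); rewrite !expr2; nra.
set D := _ / m' in key jump *.
set U := x ^+ 2 / m + _ in key *; set U' := x' ^+ 2 / m' + _ in key jump *.
have U'0 : 0 <= D by rewrite divr_ge0// sqr_ge0.
rewrite -[v * _ * _]mulrA; set L := x / m * _ in key *.
(* Right side minus left side equals twice the first of these three products plus the other two. *)
have : 0 <= v * (U' - U - 2 * L - D) by rewrite mulr_ge0//; lra.
have : 0 <= (v' - v) * (2 * U' - D) by rewrite mulr_ge0//; lra.
have : 0 <= v * D by rewrite mulr_ge0.
nra.
Qed.

(** * Monotonicity and domination for expectations *)

Section expectation.
Context {d : measure_display} {T : measurableType d} {R : realType}.
Variable P : probability T R.

(* [integral] is a supremum over simple functions from below, hence monotone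
   without measurability; this matters because [x |-> phi x (g x)] need not be
   measurable when [phi x] is merely monotone. *)
Lemma le_integral_lower (f g : T -> \bar R) :
  (forall x, 0 <= f x)%E -> (forall x, f x <= g x)%E ->
  (\int[P]_x f x <= \int[P]_x g x)%E.
Proof.
move=> f0 fg; rewrite !ge0_integralTE//; last by move=> x; exact: le_trans (fg x).
apply: le_ereal_sup => _ [h hf <-]; exists h => // x.
exact: le_trans (fg x).
Qed.

Lemma integrable_dominated (f g : T -> R) (c : R) :
  P.-integrable setT (EFin \o g) -> measurable_fun setT f ->
  (forall x, `|f x| <= c * `|g x|) -> P.-integrable setT (EFin \o f).
Proof.
move=> ig mf fg.
apply: (@le_integrable _ _ _ P setT measurableT _ (EFin \o (fun x => c * g x))).
- exact/measurable_EFinP.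
- move=> x _ /=; rewrite lee_fin normrM (le_trans (fg x))//.
  by rewrite ler_wpM2r// ler_norm.
- have := @integrableZl _ _ _ P setT measurableT c _ ig.
  by apply: eq_integrable.
Qed.

Lemma integrable_bounded (f : T -> R) (c : R) :
  measurable_fun setT f -> (forall x, `|f x| <= c) ->
  P.-integrable setT (EFin \o f).
Proof.
move=> mf fc; apply: (@integrable_dominated f (cst 1) c) => //.
- exact: finite_measure_integrable_cst.
- by move=> x; rewrite normr1 mulr1.
Qed.

End expectation.

(** * Conditional expectation *)

Section conditional_expectation.
Context {d : measure_display} {T : measurableType d} {R : realType}.
Variable P : probability T R.
Variable G : set (set T).
Hypothesis sG : sigma_algebra setT G.
Hypothesis GT : G `<=` measurable.
Local Notation TG := (g_sigma_algebraType G).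

Import HBNNSimple.

Lemma g_sigma_measurable (A : set T) : G.-sigma.-measurable A -> G A.
Proof. by rewrite measurable_g_measurableTypeE. Qed.

(** As [G] is a sigma-algebra, it coincides with the one it generates; this opens the measurability
    theory of the type [TG]. *)
Lemma G_measP (g : T -> R) :
  G_meas G g <-> measurable_fun setT (g : TG -> R).
Proof.
split=> [mg _ B mB|mg B mB].
  by rewrite setTI measurable_g_measurableTypeE//; exact: mg.
have := mg measurableT B mB.
by rewrite setTI measurable_g_measurableTypeE.
Qed.

Lemma G_meas_measurable (g : T -> R) : G_meas G g -> measurable_fun setT g.
Proof. by move=> mg _ B mB; rewrite setTI; apply: GT; exact: mg. Qed.

Lemma EFin_RintegralE (D : set T) (f : T -> R) : measurable D ->
  P.-integrable setT (EFin \o f) ->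
  (\int[P]_(x in D) (f x)%:E)%E = (\int[P]_(x in D) f x)%:E.
Proof.
move=> mD fi; rewrite /Rintegral fineK//.
by apply: integrable_fin_num => //; exact: integrableS fi.
Qed.

(** [z] is a finite combination of indicators of its level sets, which lie in [G], and [u]
    integrates to 0 over each of them. *)
Lemma integral_nnsfun_mul_eq0 (u : T -> R) (z : {nnsfun TG >-> R}) :
  P.-integrable setT (EFin \o u) ->
  (forall A, G A -> (\int[P]_(x in A) (u x)%:E = 0)%E) ->
  (\int[P]_x (z x * u x)%:E = 0)%E.
Proof.
move=> ui u0.
under eq_integral.
  move=> x _.
  rewrite (fimfunE z) fsbig_finite//= big_distrl/= -sumEFin.
  over.
have mz y : G (z @^-1` [set y]).
  apply: g_sigma_measurable.
  exact: measurable_sfunP.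
have zi y : P.-integrable setT (fun x => (y * \1_(z @^-1` [set y]) x * u x)%:E).
  apply: (@integrable_dominated _ _ _ P _ u `|y| ui).
    apply: measurable_funM; last by apply/measurable_EFinP; exact: measurable_int ui.
    apply: measurable_funM => //.
    by apply: measurable_indic; exact: GT.
  move=> x; rewrite !normrM ler_wpM2r// ler_piMr// indicE.
  by case: (_ \in _); rewrite /= ?normr1// normr0.
rewrite integral_sum//= big1// => y _.
transitivity (\int[P]_x (y%:E * ((u \_ (z @^-1` [set y])) x)%:E))%E.
  apply: eq_integral => x _; rewrite patch_indic/= -EFinM; congr EFin; ring.
rewrite integralZl//.
  have -> : (\int[P]_x ((u \_ (z @^-1` [set y])) x)%:E =
             \int[P]_(x in z @^-1` [set y]) (u x)%:E)%E.
    by rewrite [RHS]integral_mkcond; apply: eq_integral => x _; rewrite restrict_EFin.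
  by rewrite u0// mule0.
have := (integrable_mkcond (mu := P) (EFin \o u) (GT (mz y))).1.
rewrite restrict_EFin; apply.
by apply: integrableS ui => //; exact: GT.
Qed.

(** Dominated convergence along simple functions increasing to [Z]. They are built over [TG], so
    that their level sets belong to [G]; [|Z * u|] dominates. *)
Lemma integral_mul_eq0_ge0 (u Z : T -> R) :
  P.-integrable setT (EFin \o u) ->
  (forall A, G A -> (\int[P]_(x in A) (u x)%:E = 0)%E) ->
  G_meas G Z -> (forall x, 0 <= Z x) ->
  P.-integrable setT (EFin \o (fun x => Z x * u x)) ->
  (\int[P]_x (Z x * u x)%:E = 0)%E.
Proof.
move=> ui u0 /G_measP mZ Z0 Zui.
have mu : measurable_fun setT u by apply/measurable_EFinP; exact: measurable_int ui.
have mZ' : measurable_fun setT (EFin \o (Z : TG -> R)) by exact/measurable_EFinP.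
pose z := nnsfun_approx measurableT mZ'.
have zZ x : z n x @[n --> \oo] --> Z x.
  have : EFin \o z ^~ x @ \oo --> (Z x)%:E.
    by apply: (cvg_nnsfun_approx measurableT mZ') => // y _; rewrite lee_fin.
  by move=> /fine_cvgP[].
have [|||||_ _] := @dominated_convergence _ _ _ P setT measurableT
  (fun n x => (z n x * u x)%:E) (fun x => (Z x * u x)%:E)
  (fun x => `|(Z x * u x)%:E|%E).
- move=> n; apply/measurable_EFinP/measurable_funM => //.
  apply: G_meas_measurable => //; apply/G_measP; exact: measurable_funPT.
- exact: measurable_int Zui.
- apply: aeW => x _; apply: cvg_EFin; first exact: nearW.
  by apply: cvgM => //; exact: cvg_cst.
- exact: integrable_abse.
- apply: aeW => x n _ /=; rewrite lee_fin !normrM ler_wpM2r// !ger0_norm//.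
  rewrite -(cvg_lim (@Rhausdorff R) (zZ x)).
  apply: (@nondecreasing_cvgn_le _ (fun n => z n x)) => //.
  + by move=> m k mk; have /lefP := nd_nnsfun_approx measurableT mZ' mk; exact.
  + by apply/cvg_ex; exists (Z x).
- have -> : [sequence \int[P]_x (z n x * u x)%:E]_n%E = cst 0%E.
    by apply/funext => n; exact: integral_nnsfun_mul_eq0.
  by move=> /cvg_lim <- //; rewrite lim_cst.
Qed.

(** [f - g] has zero integral over every set of [G], hence against the positive and the negative
    part of [Z]. *)
Lemma cexp_version_pull_out (f g Z : T -> R) :
  cexp_version P G f g -> G_meas G Z ->
  P.-integrable setT (EFin \o (fun x => Z x * f x)) ->
  P.-integrable setT (EFin \o (fun x => Z x * g x)) ->
  \int[P]_x (Z x * g x) = \int[P]_x (Z x * f x).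
Proof.
move=> [fi mg gi fg] mZ Zf Zg.
pose u x := f x - g x.
have ui : P.-integrable setT (EFin \o u).
  by have := integrableB measurableT fi gi; apply: eq_integrable.
have mu : measurable_fun setT u by apply/measurable_EFinP; exact: measurable_int ui.
have u0 A : G A -> (\int[P]_(x in A) (u x)%:E = 0)%E.
  move=> GA; have mA := GT GA.
  under eq_integral do rewrite EFinB.
  rewrite integralB_EFin//; [|exact: integrableS fi|exact: integrableS gi].
  rewrite fg// subee//; apply: integrable_fin_num => //; exact: integrableS fi.
have Zu : P.-integrable setT (EFin \o (fun x => Z x * u x)).
  have := integrableB measurableT Zf Zg; apply: eq_integrable => //.
  by move=> x _ /=; rewrite -EFinB mulrBr.
have part (Y : T -> R) : G_meas G Y -> (forall x, 0 <= Y x) ->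
    (forall x, Y x <= `|Z x|) ->
    P.-integrable setT (EFin \o (fun x => Y x * u x)) /\
    \int[P]_x (Y x * u x) = 0.
  move=> mY Y0 YZ.
  have Yu : P.-integrable setT (EFin \o (fun x => Y x * u x)).
    apply: (@integrable_dominated _ _ _ P _ _ 1 Zu).
      by apply: measurable_funM => //; exact: G_meas_measurable.
    by move=> x; rewrite mul1r !normrM ler_wpM2r// ger0_norm.
  by split=> //; rewrite /Rintegral integral_mul_eq0_ge0.
have mZT := (G_measP Z).1 mZ.
have [|||i1 e1] := part (fun x => Num.max (Z x) 0).
- by apply/G_measP; exact: measurable_maxr.
- by move=> x; rewrite le_max lexx orbT.
- by move=> x; rewrite ge_max ler_norm normr_ge0.
have [|||i2 e2] := part (fun x => Num.max (- Z x) 0).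
- by apply/G_measP; apply: measurable_maxr => //; exact: measurable_funN.
- by move=> x; rewrite le_max lexx orbT.
- by move=> x; rewrite ge_max -normrN ler_norm normr_ge0.
apply/esym/eqP; rewrite -subr_eq0 -RintegralB//; apply/eqP.
transitivity (\int[P]_x (Num.max (Z x) 0 * u x - Num.max (- Z x) 0 * u x)).
  apply: eq_Rintegral => x _; rewrite -mulrBr -mulrBl; congr (_ * _).
  have [z0|z0] := leP 0 (Z x).
    by rewrite max_r ?oppr_le0// subr0.
  by rewrite max_l ?oppr_ge0 ?ltW// sub0r opprK.
by rewrite RintegralB// e1 e2 subrr.
Qed.

(** The Radon-Nikodym derivative, on [G], of the charge with density [h] with respect to [P].
    Restriction to [G] is expressed as push-forward along the identity map from [T] to [TG]. *)
Lemma cexp_version_exists (h : T -> R) :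
  P.-integrable setT (EFin \o h) -> exists g, cexp_version P G h g.
Proof.
move=> hi.
have mid : measurable_fun setT (id : T -> TG).
  by move=> _ B /g_sigma_measurable GB; rewrite setTI; exact: GT.
pose X : {mfun T >-> TG} := HB.pack (id : T -> TG) (isMeasurableFun.Build _ _ _ _ _ mid).
pose mu := distribution P X.
pose nu : {charge set TG -> \bar R} :=
  
  measure_function_pushforward__canonical__charge_Charge (induced_charge hi) mid.
have numu : nu `<< mu.
  apply/null_content_dominatesP => A /g_sigma_measurable GA muA0.
  have mA := GT GA.
  rewrite /nu/= /pushforward/= /induced_charge null_set_integral//.
  by apply/measurable_funTS; exact: measurable_int hi.
have gi := Radon_Nikodym_integrable numu.
have gfin x := Radon_Nikodym_fin_num x numu.
pose g : T -> R := fun x => fine (Radon_Nikodym nu mu x).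
have gE : EFin \o g = Radon_Nikodym nu mu by apply/funext => x /=; rewrite /g fineK.
have mg : measurable_fun setT (g : TG -> R).
  by apply/measurable_EFinP; rewrite gE; exact: measurable_int gi.
have Gg : G_meas G g by exact/G_measP.
have giP : P.-integrable setT (EFin \o g).
  apply/integrableP; split.
    by apply/measurable_EFinP; exact: G_meas_measurable.
  have /integrableP[_] := gi.
  rewrite ge0_integral_pushforward//=.
    by apply: le_lt_trans; rewrite le_eqVlt; apply/orP; left; apply/eqP; apply: eq_integral => x _; rewrite -gE.
  by apply: measurableT_comp => //; exact: measurable_int gi.
exists g; split => // A GA.
have mA : measurable (A : set TG) by rewrite measurable_g_measurableTypeE.
have := Radon_Nikodym_integral numu mA.
rewrite {1}/nu/= /pushforward/= /induced_charge => ->.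
rewrite integral_pushforward//=.
- by apply: eq_integral => x _; rewrite -gE.
- have : P.-integrable A (EFin \o g) by apply: integrableS giP => //; exact: GT.
  by apply: (eq_integrable (GT GA)) => x _ /=; rewrite -gE.
Qed.

(** The set where [g1 > g2] belongs to [G], so the integral of [g1 - g2] over it equals that of
    [h1 - h2], which is nonpositive; hence the positive part of [g1 - g2] vanishes almost
    everywhere. *)
Lemma cexp_version_le (h1 h2 g1 g2 : T -> R) :
  cexp_version P G h1 g1 -> cexp_version P G h2 g2 ->
  (forall x, h1 x <= h2 x) -> {ae P, forall x, g1 x <= g2 x}.
Proof.
move=> [hi1 mg1 gi1 e1] [hi2 mg2 gi2 e2] h12.
pose u x := Num.max (g1 x - g2 x) 0.
have mu : G_meas G u.
  apply/G_measP; apply: measurable_maxr => //.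
  by apply: measurable_funB; exact/G_measP.
pose A := [set x | u x != 0].
have GA : G A.
  have := mu [set~ 0] (measurableC (measurable_set1 0)).
  by congr G; apply/seteqP; split=> x /=; rewrite /A/= => /eqP.
have mA := GT GA.
have uE : (\int[P]_x `|(u x)%:E| = 0)%E.
  apply/eqP; rewrite eq_le integral_ge0// andbT.
  have -> : (\int[P]_x `|(u x)%:E| = \int[P]_(x in A) (g1 x - g2 x)%:E)%E.
    rewrite [RHS]integral_mkcond; apply: eq_integral => x _.
    rewrite patchE; have [ux|ux] := eqVneq (u x) 0.
      by rewrite ux memNset ?abse0// /A/= ux eqxx.
    rewrite mem_set//; move: ux; rewrite /u /Num.max; case: ltP => [|gl _].
      by rewrite eqxx.
    by rewrite /= ger0_norm.
  under eq_integral do rewrite EFinB.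
  have iS h : P.-integrable setT (EFin \o h) -> P.-integrable A (EFin \o h).
    by move=> hi; exact: integrableS hi.
  rewrite integralB_EFin//; [|exact: iS..].
  rewrite e1// e2// sube_le0; apply: le_integral => //; [exact: iS..|].
  by move=> x _; rewrite lee_fin.
have /ae_eq_integral_abs := uE.
move=> /(_ measurableT); case.
  by apply/measurable_EFinP; exact: G_meas_measurable.
move=> N [mN PN0 sN]; exists N; split => // x /= gx; apply: sN => /= /(_ I).
by move=> [] /eqP; rewrite /u eq_le ge_max subr_le0 lexx andbT => /andP[].
Qed.

Lemma cexp_version_cst (c : R) : cexp_version P G (cst c) (cst c).
Proof.
have ci : P.-integrable setT (EFin \o cst c) by exact: finite_measure_integrable_cst.
by split => //; apply/G_measP; exact: measurable_cst.
Qed.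

Lemma cexp_versionN (h g : T -> R) :
  cexp_version P G h g -> cexp_version P G (fun x => - h x) (fun x => - g x).
Proof.
move=> [hi mg gi e].
have opp_int k : P.-integrable setT (EFin \o k) ->
    P.-integrable setT (EFin \o (fun x => - k x)).
  by move=> ki; have := integrableN ki; exact: eq_integrable.
split; [exact: opp_int| |exact: opp_int|].
  by apply/G_measP; apply: measurable_funN; exact/G_measP.
move=> A GA; have mA := GT GA.
have iS k : P.-integrable setT (EFin \o k) -> P.-integrable A (EFin \o k).
  by move=> ki; exact: integrableS ki.
rewrite !EFin_RintegralE//; [|exact: opp_int..].
have E k : \int[P]_(x in A) - k x = \int[P]_(x in A) (- 1 * k x).
  by apply: eq_Rintegral => x _; rewrite mulN1r.
rewrite !E !RintegralZl//; [|exact: iS..].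
by have := e A GA; rewrite !EFin_RintegralE// => -[->].
Qed.

(** Truncating any version between [g1] and [g2] changes it on a null set only and turns almost sure
    bounds into bounds at every point. This keeps exceptional sets out of the later pointwise
    estimates. *)
Lemma cexp_version_between (h h1 h2 g1 g2 : T -> R) :
  P.-integrable setT (EFin \o h) ->
  (forall x, h1 x <= h x) -> (forall x, h x <= h2 x) ->
  cexp_version P G h1 g1 -> cexp_version P G h2 g2 ->
  (forall x, g1 x <= g2 x) ->
  exists g, cexp_version P G h g /\ forall x, g1 x <= g x <= g2 x.
Proof.
move=> hi h1h hh2 v1 v2 g12.
have [g v] := cexp_version_exists hi.
pose g' x := Num.max (g1 x) (Num.min (g x) (g2 x)).
have mg' : G_meas G g'.
  case: v1 v2 v => [_ ? _ _] [_ ? _ _] [_ ? _ _].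
  apply/G_measP; apply: measurable_maxr; first exact/G_measP.
  by apply: measurable_minr; exact/G_measP.
have gg' x : g1 x <= g' x <= g2 x by rewrite le_max lexx/= ge_max g12 ge_min lexx orbT.
have ae_g : {ae P, forall x, g x = g' x}.
  have := cexp_version_le v v2 hh2.
  apply: filterS2 (cexp_version_le v1 v h1h) => x xl xr.
  by rewrite /g' min_l// max_r.
exists g'; split => //.
have [_ mg gi ge] := v.
have mg'T := G_meas_measurable mg'; have mgT := G_meas_measurable mg.
have g'E A : measurable A -> (\int[P]_(x in A) (g' x)%:E = \int[P]_(x in A) (g x)%:E)%E.
  move=> mA; apply: ae_eq_integral => //.
  - by apply/measurable_EFinP; exact: measurable_funTS.
  - by apply/measurable_EFinP; exact: measurable_funTS.
  - by apply: filterS ae_g => x -> _.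
split => //; last by move=> A GA; rewrite g'E ?ge//; exact: GT.
have [_ _ gi1 _] := v1; have [_ _ gi2 _] := v2.
have gi12 : P.-integrable setT (EFin \o (fun x => `|g1 x| + `|g2 x|)).
  have := integrableD measurableT (integrable_norm gi1) (integrable_norm gi2).
  by apply: eq_integrable.
apply: (@integrable_dominated _ _ _ P _ _ 1 gi12) => // x.
have /andP[gl gr] := gg' x.
rewrite mul1r [leRHS]ger0_norm ?addr_ge0// ler_norml.
move: (ler_norm (g2 x)) (ler_norm (- g1 x)); rewrite normrN => l2 l1.
apply/andP; split; first by rewrite (le_trans _ gl)// lerNl (le_trans l1)// lerDl.
by rewrite (le_trans gr)// (le_trans l2)// lerDr.
Qed.

End conditional_expectation.

(** * Running maxima and square functions *)

Lemma normr_div_le (R : realFieldType) (x m c : R) :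
  0 <= c -> `|x| <= c * m -> `|x / m| <= c.
Proof.
move=> c0 xm; rewrite normrM normfV.
have [->|m0] := eqVneq m 0; first by rewrite normr0 invr0 mulr0.
rewrite ler_pdivrMr ?normr_gt0//; apply: le_trans xm _.
by rewrite ler_wpM2l// ler_norm.
Qed.

Lemma sqr_div_le (R : realFieldType) (x m c : R) :
  0 <= c -> 0 <= m -> `|x| <= c * m -> 0 <= x ^+ 2 / m <= c ^+ 2 * m.
Proof.
move=> c0 m0 xm; rewrite divr_ge0 ?sqr_ge0//=.
move: m0; rewrite le_eqVlt => /predU1P[<-|m0]; first by rewrite invr0 !mulr0.
rewrite ler_pdivrMr// -mulrA -expr2 -exprMn -real_normK ?num_real//.
by rewrite lerXn2r// ?nnegrE// mulr_ge0// ltW.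
Qed.

(* Young's inequality for the weights [v' / s'] and [s' / v'], with
   [y ^+ 2 / s' = (s' - s) * (s' + s) / s' <= 2 * (s' - s)]. *)
Lemma increment_young (R : realFieldType) (y z s s' v v' : R) :
  0 <= s -> s <= s' -> y ^+ 2 = s' ^+ 2 - s ^+ 2 -> `|z| <= 2 * v' -> v' <= v ->
  2 * (y * z) <= 2 * ((s' - s) * v) + s' * (z ^+ 2 / v').
Proof.
move=> s0 ss' yE zv v'v.
have v'0 : 0 <= v' by move: (le_trans (normr_ge0 z) zv); rewrite pmulr_rge0.
have s'0 : 0 <= s' by exact: le_trans ss'.
have h0 : 0 <= (s' - s) * v by rewrite mulr_ge0 ?subr_ge0// (le_trans v'0).
move: s'0; rewrite le_eqVlt => /predU1P[s'E|s'p].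
  have sE : s = 0 by apply/eqP; rewrite eq_le s0 andbT; move: ss'; rewrite -s'E.
  have -> : y = 0 by apply/eqP; rewrite -sqrf_eq0 yE sE -s'E subrr.
  by rewrite mul0r mulr0 -[X in _ + X * _]s'E mul0r addr0 mulr_ge0.
move: v'0; rewrite le_eqVlt => /predU1P[v'E|v'p].
  have -> : z = 0 by apply/normr0_eq0/eqP; rewrite eq_le normr_ge0 andbT (le_trans zv)// -v'E mulr0.
  by rewrite mulr0 mulr0 expr0n/= mul0r mulr0 addr0 mulr_ge0.
apply: (@le_trans _ _ (2 * ((s' - s) * v') + s' * (z ^+ 2 / v'))); last first.
  by rewrite lerD2r !ler_wpM2l// subr_ge0.
rewrite -subr_ge0.
have -> : 2 * ((s' - s) * v') + s' * (z ^+ 2 / v') - 2 * (y * z) =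
  ((s' * z - v' * y) ^+ 2 + v' ^+ 2 * (2 * s' * (s' - s) - y ^+ 2)) / (s' * v').
  by field; rewrite !gt_eqF.
rewrite divr_ge0 ?mulr_ge0 ?(ltW s'p) ?(ltW v'p)//.
rewrite addr_ge0 ?sqr_ge0// mulr_ge0 ?sqr_ge0// yE.
by have := sqr_ge0 (s' - s); rewrite !expr2; nra.
Qed.

(** The inverse is written as [x] times the power -1 of [x ^+ 2], a real power of a nonnegative
    quantity; at 0 both sides are 0. *)
Lemma measurable_invr (R : realType) : measurable_fun setT (@GRing.inv R).
Proof.
rewrite [X in measurable_fun _ X](_ : _ = fun x => x * (x ^+ 2) `^ (- 1)).
  apply: measurable_funM => //; apply: (measurableT_comp (measurable_powR _)).
  exact: exprn_measurable.
apply/funext => x; rewrite powR_inv1 ?sqr_ge0//.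
have [->|x0] := eqVneq x 0; first by rewrite invr0 mul0r.
by rewrite expr2 invfM mulrA divff// mul1r.
Qed.

Lemma measurable_sqrtr (R : realType) : measurable_fun setT (@Num.sqrt R).
Proof. by apply: continuous_measurable_fun; exact: sqrt_continuous. Qed.

Section running.
Context {T : Type} {R : realType}.
Implicit Type h : nat -> T -> R.

Fixpoint running_max h n x : R :=
  if n is n'.+1 then Num.max (running_max h n' x) `|h n x| else `|h 0 x|.

Definition square_fun h n x : R :=
  Num.sqrt (\sum_(j < n) (h j.+1 x - h j x) ^+ 2).

Lemma running_max_ge h n k x : (k <= n)%N -> `|h k x| <= running_max h n x.
Proof.
elim: n => [|n ih]; first by rewrite leqn0 => /eqP ->.
rewrite leq_eqVlt => /predU1P[->|kn] /=; first by rewrite le_max lexx orbT.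
by rewrite le_max ih.
Qed.

Lemma running_max_ge0 h n x : 0 <= running_max h n x.
Proof. exact: le_trans (running_max_ge h x (leqnn n)). Qed.

Lemma running_maxS h n x : running_max h n x <= running_max h n.+1 x.
Proof. by rewrite /= le_max lexx. Qed.

Lemma running_max_homo h x : {homo running_max h ^~ x : m n / (m <= n)%N >-> m <= n}.
Proof. by apply: homo_leq => // [? ? ?|n]; [exact: le_trans|exact: running_maxS]. Qed.

Lemma running_max_le h n x c : (forall k, `|h k x| <= c) -> running_max h n x <= c.
Proof. by move=> hc; elim: n => [|n ih] //=; rewrite ge_max ih hc. Qed.

Lemma square_fun_ge0 h n x : 0 <= square_fun h n x.
Proof. exact: sqrtr_ge0. Qed.

Lemma sqr_square_fun h n x :
  square_fun h n x ^+ 2 = \sum_(j < n) (h j.+1 x - h j x) ^+ 2.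
Proof. by rewrite sqr_sqrtr// sumr_ge0// => i _; exact: sqr_ge0. Qed.

Lemma sqr_square_funS h n x :
  square_fun h n.+1 x ^+ 2 = square_fun h n x ^+ 2 + (h n.+1 x - h n x) ^+ 2.
Proof. by rewrite !sqr_square_fun big_ord_recr. Qed.

Lemma square_fun0 h x : square_fun h 0 x = 0.
Proof. by rewrite /square_fun big_ord0 sqrtr0. Qed.

Lemma square_funS h n x : square_fun h n x <= square_fun h n.+1 x.
Proof.
rewrite -(@ler_pXn2r _ 2)// ?nnegrE ?square_fun_ge0//.
by rewrite sqr_square_funS lerDl sqr_ge0.
Qed.

Lemma square_fun_homo h x : {homo square_fun h ^~ x : m n / (m <= n)%N >-> m <= n}.
Proof. by apply: homo_leq => // [? ? ?|n]; [exact: le_trans|exact: square_funS]. Qed.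

Lemma square_funS_le h n x :
  square_fun h n.+1 x <= square_fun h n x + `|h n.+1 x - h n x|.
Proof.
have s0 := square_fun_ge0 h n x.
rewrite -(@ler_pXn2r _ 2)// ?nnegrE ?square_fun_ge0 ?addr_ge0//.
rewrite sqr_square_funS [leRHS]sqrrD real_normK ?num_real// lerD2r lerDl.
by rewrite mulrn_wge0// mulr_ge0.
Qed.

End running.

(** * Adaptedness and integrability of running maxima and square functions *)

Section weighted.
Context {d : measure_display} {T : measurableType d} {R : realType}.
Variable P : probability T R.
Variable F : nat -> set (set T).
Hypothesis FF : filtration F.
Local Notation I f := (P.-integrable setT (EFin \o f)).

Let sF n : sigma_algebra setT (F n). Proof. by case: FF. Qed.
Let FT n : F n `<=` measurable. Proof. by case: FF. Qed.

Lemma G_meas_le (n m : nat) (g : T -> R) : (n <= m)%N -> G_meas (F n) g -> G_meas (F m) g.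
Proof. by case: FF => _ _ H nm mg B mB; apply: H nm _ _; exact: mg. Qed.

Implicit Type h : nat -> T -> R.

Section G_meas_closure.
Variable n : nat.
Implicit Type g : T -> R.
Local Notation M := (G_meas (F n)).

Lemma G_measD g g' : M g -> M g' -> M (fun x => g x + g' x).
Proof.
by move=> /(G_measP (sF n)) ? /(G_measP (sF n)) ?; apply/(G_measP (sF n)); exact: measurable_funD.
Qed.

Lemma G_measB g g' : M g -> M g' -> M (fun x => g x - g' x).
Proof.
by move=> /(G_measP (sF n)) ? /(G_measP (sF n)) ?; apply/(G_measP (sF n)); exact: measurable_funB.
Qed.

Lemma G_measM g g' : M g -> M g' -> M (fun x => g x * g' x).
Proof.
by move=> /(G_measP (sF n)) ? /(G_measP (sF n)) ?; apply/(G_measP (sF n)); exact: measurable_funM.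
Qed.

Lemma G_meas_max g g' : M g -> M g' -> M (fun x => Num.max (g x) (g' x)).
Proof.
by move=> /(G_measP (sF n)) ? /(G_measP (sF n)) ?; apply/(G_measP (sF n)); exact: measurable_maxr.
Qed.

Lemma G_meas_comp (u : R -> R) g : measurable_fun setT u -> M g -> M (u \o g).
Proof.
by move=> mu /(G_measP (sF n)) ?; apply/(G_measP (sF n)); exact: measurableT_comp.
Qed.

Lemma G_measV g : M g -> M (fun x => (g x)^-1).
Proof. by move=> mg; exact: (G_meas_comp (@measurable_invr R) mg). Qed.

Lemma G_measX g k : M g -> M (fun x => g x ^+ k).
Proof. by move=> mg; exact: (G_meas_comp (exprn_measurable k) mg). Qed.

End G_meas_closure.

Lemma G_meas_running_max h n : (forall k, G_meas (F k) (h k)) ->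
  G_meas (F n) (running_max h n).
Proof.
move=> mh; elim: n => [|n ih] /=.
  exact: (G_meas_comp (@normr_measurable R setT) (mh 0%N)).
apply: G_meas_max; first exact: G_meas_le ih.
exact: (G_meas_comp (@normr_measurable R setT) (mh n.+1)).
Qed.

Lemma G_meas_square_fun h n : (forall k, G_meas (F k) (h k)) ->
  G_meas (F n) (square_fun h n).
Proof.
move=> mh; apply: (@G_meas_comp n Num.sqrt); first exact: measurable_sqrtr.
apply/(G_measP (sF n)).
rewrite (_ : (fun x => _) = fun x => \sum_(0 <= j < n) (h j.+1 x - h j x) ^+ 2); last first.
  by apply/funext => x; rewrite big_mkord.
(* The induction runs on the upper summation bound, the outer [j], while the sigma-algebra stays
   [F n]; the summation index shadows that name. *)
suff H j : (j <= n)%N -> G_meas (F n) (fun x => \sum_(0 <= j < j) (h j.+1 x - h j x) ^+ 2).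
  by apply/(G_measP (sF n)); exact: H.
elim: j => [_|j ih jn].
  rewrite (_ : (fun x => _) = cst 0); last by apply/funext => x; rewrite big_geq.
  by apply/(G_measP (sF n)).
rewrite (_ : (fun x => _) = fun x => \sum_(0 <= j < j) (h j.+1 x - h j x) ^+ 2
  + (h j.+1 x - h j x) ^+ 2); last by apply/funext => x; rewrite big_nat_recr.
apply: G_measD; first exact/ih/ltnW.
by apply/G_measX/G_measB; [exact: G_meas_le jn _|exact: G_meas_le (ltnW jn) _].
Qed.

Lemma integrable_runmax h n : (forall k, G_meas (F k) (h k)) -> (forall k, I (h k)) ->
  I (running_max h n).
Proof.
move=> mh ih; elim: n => [|n ihn] /=; first exact: integrable_norm (ih 0%N).
have iD : I (fun x => running_max h n x + `|h n.+1 x|).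
  have := integrableD measurableT ihn (integrable_norm (ih n.+1)).
  exact: eq_integrable.
apply: (@integrable_dominated _ _ _ P _ _ 1 iD).
  apply: (G_meas_measurable (@FT n.+1)); exact: (G_meas_running_max n.+1 mh).
move=> x; have m0 := running_max_ge0 h n x.
rewrite mul1r (ger0_norm (running_max_ge0 h n.+1 x)) ger0_norm ?addr_ge0//.
by rewrite ge_max lerDl lerDr m0 normr_ge0.
Qed.

(** The squared increments may fail to be integrable, so the induction bounds each square function
    by the previous one plus the absolute value of the new increment. *)
Lemma integrable_square_fun h n : (forall k, G_meas (F k) (h k)) -> (forall k, I (h k)) ->
  I (square_fun h n).
Proof.
move=> mh ih; elim: n => [|n ihn] /=.
  rewrite (_ : square_fun h 0 = cst 0); last by apply/funext => x; exact: square_fun0.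
  exact: finite_measure_integrable_cst.
have iB : I (fun x => h n.+1 x - h n x).
  by have := integrableB measurableT (ih n.+1) (ih n); exact: eq_integrable.
have iD : I (fun x => square_fun h n x + `|h n.+1 x - h n x|).
  have := integrableD measurableT ihn (integrable_norm iB).
  exact: eq_integrable.
apply: (@integrable_dominated _ _ _ P _ _ 1 iD).
  apply: (G_meas_measurable (@FT n.+1)); exact: G_meas_square_fun.
move=> x; rewrite mul1r ger0_norm ?square_fun_ge0//.
by rewrite (le_trans (square_funS_le _ _ _))// ler_norm.
Qed.

End weighted.

(** * Weighted Davis inequalities *)

Section weighted_davis.
Context {d : measure_display} {T : measurableType d} {R : realType}.
Variable P : probability T R.
Variable F : nat -> set (set T).
Hypothesis FF : filtration F.
Variable f : nat -> T -> R.
Hypothesis mf : martingale0 P F f.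
Variables (w : T -> R) (wn : nat -> T -> R) (L : R).
Hypothesis mw : measurable_fun setT w.
Hypothesis wL : forall x, 0 <= w x <= L.
Hypothesis wnL : forall n x, 0 <= wn n x <= L.
Hypothesis wnE : forall n, cexp_version P (F n) w (wn n).

Local Notation I f := (P.-integrable setT (EFin \o f)).
Local Notation Ex f := (Rintegral P setT f).
Local Notation m := (running_max f).
Local Notation v := (running_max wn).
Local Notation s := (square_fun f).
Local Notation Df j x := (f j.+1 x - f j x).

Let sF n : sigma_algebra setT (F n). Proof. by case: FF. Qed.
Let FT n : F n `<=` measurable. Proof. by case: FF. Qed.
Let Mf n : G_meas (F n) (f n). Proof. by case: mf. Qed.
Let If n : I (f n). Proof. by case: mf. Qed.
Let Mwn n : G_meas (F n) (wn n). Proof. by case: (wnE n). Qed.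
Let Mm n : G_meas (F n) (m n). Proof. exact: G_meas_running_max. Qed.
Let Ms n : G_meas (F n) (s n). Proof. exact: G_meas_square_fun. Qed.
Let Mv n : G_meas (F n) (v n). Proof. exact: G_meas_running_max. Qed.
Let Im n : I (m n). Proof. exact: (integrable_runmax FF). Qed.
Let Is n : I (s n). Proof. exact: (integrable_square_fun FF). Qed.
Let w0 x : 0 <= w x. Proof. by case/andP: (wL x). Qed.
Let wleL x : w x <= L. Proof. by case/andP: (wL x). Qed.
Let wn0 n x : 0 <= wn n x. Proof. by case/andP: (wnL n x). Qed.
Let v0 n x : 0 <= v n x. Proof. exact: running_max_ge0. Qed.
Let m0 n x : 0 <= m n x. Proof. exact: running_max_ge0. Qed.
Let s0 n x : 0 <= s n x. Proof. exact: square_fun_ge0. Qed.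
Let wnv n x : wn n x <= v n x.
Proof. exact: le_trans (ler_norm _) (running_max_ge _ _ (leqnn n)). Qed.
Let vL n x : v n x <= L.
Proof. by apply: running_max_le => k; rewrite ger0_norm//; case/andP: (wnL k x). Qed.
Let L0 : 0 <= L. Proof. exact: le_trans (wleL point). Qed.

Let mono n k (g : T -> R) : (n <= k)%N -> G_meas (F n) g -> G_meas (F k) g.
Proof. exact: G_meas_le. Qed.
Let meas n (g : T -> R) : G_meas (F n) g -> measurable_fun setT g.
Proof. by apply: G_meas_measurable; exact: FT. Qed.

Lemma Rintegral_martingale_diff n (Z : T -> R) c :
  G_meas (F n) Z -> (forall x, `|Z x| <= c) ->
  I (fun x => Z x * Df n x) /\ Ex (fun x => Z x * Df n x) = 0.
Proof.
move=> MZ Zc.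
have IZ k : I (fun x => Z x * f k x).
  apply: (integrable_dominated (c := c) (If k)).
    by apply: measurable_funM; [exact: meas MZ|exact: meas (@Mf k)].
  by move=> x; rewrite normrM ler_wpM2r.
have -> : (fun x => Z x * Df n x) = (fun x => Z x * f n.+1 x - Z x * f n x).
  by apply/funext => x; rewrite mulrBr.
split.
  by have := integrableB measurableT (IZ n.+1) (IZ n); exact: eq_integrable.
have vf : cexp_version P (F n) (f n.+1) (f n) by case: mf.
by rewrite RintegralB// (cexp_version_pull_out (sF n) (@FT n) vf MZ)// subrr.
Qed.

Lemma integrable_mul_bounded (X Y : T -> R) c :
  I X -> measurable_fun setT Y -> (forall x, `|Y x| <= c) -> I (fun x => X x * Y x).
Proof.
move=> IX mY Yc; apply: (integrable_dominated (c := c) IX).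
  by apply: measurable_funM => //; apply/measurable_EFinP; exact: measurable_int IX.
by move=> x; rewrite normrM mulrC ler_wpM2r.
Qed.

Let Iw (X : T -> R) : I X -> I (fun x => X x * w x).
Proof. by move=> IX; apply: (integrable_mul_bounded (c := L)) => // x; rewrite ger0_norm. Qed.

Let Iwn n (X : T -> R) : I X -> I (fun x => X x * wn n x).
Proof.
move=> IX; apply: (integrable_mul_bounded (c := L)) => //; first exact: meas.
by move=> x; rewrite ger0_norm//; case/andP: (wnL n x).
Qed.

Let Iv n (X : T -> R) : I X -> I (fun x => X x * v n x).
Proof.
move=> IX; apply: (integrable_mul_bounded (c := L)) => //; first exact: meas.
by move=> x; rewrite ger0_norm.
Qed.

(** [X] is known at time [n], so [w] may be replaced by its conditional expectation [wn n], which
    lies below [v n]. *)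
Lemma Rintegral_weight_le n (X : T -> R) :
  G_meas (F n) X -> I X -> (forall x, 0 <= X x) ->
  Ex (fun x => X x * w x) <= Ex (fun x => X x * v n x).
Proof.
move=> MX IX X0.
rewrite -(cexp_version_pull_out (sF n) (@FT n) (wnE n) MX (Iw IX) (Iwn n IX)).
apply: le_Rintegral => //; [exact: Iwn|exact: Iv|].
by move=> x _; rewrite ler_wpM2l.
Qed.

Let fm n x : `|f n x| <= 1 * m n x. Proof. by rewrite mul1r; exact: running_max_ge. Qed.
Let Dm n x : `|Df n x| <= 2 * m n.+1 x.
Proof.
rewrite (le_trans (ler_normB _ _))// mulr_natl mulr2n lerD//.
  exact: running_max_ge.
exact: running_max_ge (leqnSn n).
Qed.

(** Normalised squared increment, known at time [j.+1]. Where the running maximum is 0 the increment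
    is 0 too, so the default value of the quotient loses nothing. *)
Let a j x := Df j x ^+ 2 / m j.+1 x.
Let U j x := v j x * (f j x ^+ 2 / m j x + 2 * m j x).

Let aE j x : 0 <= a j x <= 2 ^+ 2 * m j.+1 x.
Proof. exact: sqr_div_le. Qed.

Let Ma j : G_meas (F j.+1) (a j).
Proof.
apply: (G_measM FF); last exact: (G_measV FF).
by apply/(G_measX FF)/(G_measB FF) => //; exact: mono (leqnSn j) (Mf j).
Qed.

Let Ia j : I (a j).
Proof.
apply: (integrable_dominated (c := 2 ^+ 2) (Im j.+1)); first exact: meas (Ma j).
by move=> x; have /andP[? ?] := aE j x; rewrite !ger0_norm.
Qed.

Let UE j x : 0 <= U j x <= 3 * (m j x * v j x).
Proof.
have /andP[h1 h2] : 0 <= f j x ^+ 2 / m j x <= 1 ^+ 2 * m j x by exact: sqr_div_le.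
rewrite expr1n mul1r in h2.
apply/andP; split; first by rewrite mulr_ge0// addr_ge0// mulr_ge0.
by rewrite (mulrC (m j x)) mulrCA ler_wpM2l//; lra.
Qed.

Let IU j : I (U j).
Proof.
apply: (integrable_dominated (c := 3) (Iv j (Im j))).
  apply: (@meas j); apply: (G_measM FF) => //; apply: (G_measD FF).
    by apply: (G_measM FF); [exact: (G_measX FF)|exact: (G_measV FF)].
  by apply: (G_measM FF) => //; apply/G_measP => //; exact: measurable_cst.
by move=> x; have /andP[? ?] := UE j x; rewrite !ger0_norm// mulr_ge0.
Qed.

(** Each new term is paid for by twice the increment of the potential: [a n] is known at time
    [n.+1], so [w] gives way to [v n.+1], and the linear term of [davis_step] has mean zero. *)
Lemma Rintegral_sum_sqr_diff n :
  \sum_(j < n) Ex (fun x => a j x * w x) <= 2 * Ex (U n).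
Proof.
elim: n => [|n ih].
  rewrite big_ord0 mulr_ge0// Rintegral_ge0// => x _.
  by case/andP: (UE 0 x).
rewrite big_ord_recr/=.
suff : Ex (fun x => a n x * w x) <= 2 * (Ex (U n.+1) - Ex (U n)) by lra.
(* Coefficient of that linear term, known at time [n] and bounded by [L] because [|f n| <= m n]. *)
pose Z x := v n x * (f n x / m n x).
have Zc x : `|Z x| <= L.
  rewrite normrM (ger0_norm (v0 n x)) -[leRHS]mulr1 ler_pM//.
  exact: normr_div_le.
have MZ : G_meas (F n) Z.
  by apply: (G_measM FF) => //; apply: (G_measM FF) => //; exact: (G_measV FF).
have [IZ EZ] := Rintegral_martingale_diff MZ Zc.
apply: (le_trans (Rintegral_weight_le (Ma n) (Ia n) _)).
  by move=> x; case/andP: (aE n x).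
have IUU : I (fun x => U n.+1 x - U n x).
  by have := integrableB measurableT (IU n.+1) (IU n); exact: eq_integrable.
have I2Z : I (fun x => 2 * (Z x * Df n x)).
  by have := integrableZl measurableT 2 IZ; exact: eq_integrable.
have IT : I (fun x => U n.+1 x - U n x - 2 * (Z x * Df n x)).
  by have := integrableB measurableT IUU I2Z; exact: eq_integrable.
have -> : Ex (U n.+1) - Ex (U n) = Ex (fun x => U n.+1 x - U n x - 2 * (Z x * Df n x)).
  by rewrite !RintegralB// RintegralZl// EZ mulr0 subr0.
rewrite -RintegralZl//; apply: le_Rintegral => //; first exact: Iv.
  by have := integrableZl measurableT 2 IT; exact: eq_integrable.
move=> x _; rewrite mulrC; apply: davis_step => //.
- by have := fm n x; rewrite mul1r.
- by have := fm n.+1 x; rewrite mul1r.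
- exact: running_maxS.
- exact: running_maxS.
Qed.

(** From [s n ^+ 2 <= m n * \sum_j a j] and the inequality of means, [2 * s n <= m n + \sum_j a j].
    After weighting, the first term contributes 1 and the potential [2 * 3], which gives [7 / 2],
    rounded up to 4. *)
Lemma weighted_square_le_max n :
  Ex (fun x => s n x * w x) <= 4 * Ex (fun x => m n x * v n x).
Proof.
have Isum : I (fun x => \sum_(j < n) (a j x * w x)).
  have : P.-integrable setT (fun x => (\sum_(j < n) (a j x * w x)%:E)%E).
    by apply: integrable_sum => // i _; exact: (Iw (Ia i)).
  by apply: eq_integrable => // x _ /=; rewrite sumEFin.
have Imsum : I (fun x => m n x * w x + \sum_(j < n) (a j x * w x)).
  by have := integrableD measurableT (Iw (Im n)) Isum; exact: eq_integrable.
suff : 2 * Ex (fun x => s n x * w x) <= Ex (fun x => m n x * w x) + 2 * Ex (U n).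
  have hU : Ex (U n) <= 3 * Ex (fun x => m n x * v n x).
    rewrite -RintegralZl//; last exact: Iv.
    apply: le_Rintegral => //; first exact: IU.
      by have := integrableZl measurableT 3 (Iv n (Im n)); exact: eq_integrable.
    by move=> x _; case/andP: (UE n x).
  have := Rintegral_weight_le (Mm n) (Im n) (m0 n).
  have : 0 <= Ex (fun x => m n x * v n x).
    by apply: Rintegral_ge0 => x _; exact: mulr_ge0.
  lra.
apply: (@le_trans _ _ (Ex (fun x => m n x * w x) + \sum_(j < n) Ex (fun x => a j x * w x))); last first.
  by rewrite lerD2l; exact: Rintegral_sum_sqr_diff.
rewrite -RintegralZl//; last exact: Iw.
apply: (@le_trans _ _ (Ex (fun x => m n x * w x + \sum_(j < n) (a j x * w x)))).
  apply: le_Rintegral => //.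
    by have := integrableZl measurableT 2 (Iw (Is n)); exact: eq_integrable.
  move=> x _; rewrite -mulr_suml -mulrDl mulrA ler_wpM2r//.
  have A0 : 0 <= \sum_(j < n) a j x by apply: sumr_ge0 => j _; case/andP: (aE j x).
  rewrite -(@ler_pXn2r _ 2)// ?nnegrE ?mulr_ge0 ?addr_ge0//.
  have : s n x ^+ 2 <= m n x * \sum_(j < n) a j x.
    rewrite sqr_square_fun mulr_sumr; apply: ler_sum => j _.
    have mj : m j.+1 x <= m n x by apply: (running_max_homo f x); exact: ltn_ord.
    have /andP[aj _] := aE j x.
    apply: (@le_trans _ _ (m j.+1 x * a j x)); last by rewrite ler_wpM2r.
    rewrite /a; have [mE|mN] := eqVneq (m j.+1 x) 0; last by rewrite mulrCA divff// mulr1.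
    have := Dm j x; rewrite mE mulr0 normr_le0 => /eqP ->.
    by rewrite expr0n/= mul0r.
  by rewrite exprMn; have := sqr_ge0 (m n x - \sum_(j < n) a j x); rewrite !expr2; nra.
rewrite RintegralD//; last exact: Iw.
rewrite lerD2l /Rintegral.
under eq_integral do rewrite -sumEFin.
rewrite integral_sum//; last by move=> j; exact: (Iw (Ia j)).
rewrite -sum_fine//.
by move=> j _; apply: integrable_fin_num => //; exact: (Iw (Ia j)).
Qed.

(** A measurable selection of a maximising index: when [|f n.+1|] strictly exceeds the previous
    maximum, all the mass moves to [n.+1] with the sign of [f n.+1]; otherwise the coefficients
    stay. They depend on later values of the path, so they need not be adapted, and conditional
    expectations enter below. *)
Lemma running_max_linearization n : exists th : nat -> T -> R,
  [/\ forall k, measurable_fun setT (th k),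
      forall x, \sum_(k < n.+1) `|th k x| <= 1
    & forall x, \sum_(k < n.+1) th k x * f k x = m n x].
Proof.
have sgM k : measurable_fun setT (fun x => Num.sg (f k x)).
  have msg : measurable_fun setT (@Num.sg R).
    apply: nondecreasing_measurable => // x y xy.
    have [x0|x0|x0] := ltrgt0P x.
    - by rewrite (gtr0_sg x0) gtr0_sg// (lt_le_trans x0).
    - have : `|Num.sg y| <= 1 by rewrite normr_sg; case: (_ != _).
      by rewrite (ltr0_sg x0) ler_norml => /andP[].
    - by rewrite x0 sgr0 sgr_ge0 -x0.
  exact: (measurableT_comp msg (meas (@Mf k))).
have sgE k x : Num.sg (f k x) * f k x = `|f k x| by rewrite normrEsg.
have sg1 k x : `|Num.sg (f k x)| <= 1 by rewrite normr_sg; case: (_ != _).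
elim: n => [|n [th [mth th1 thE]]].
  exists (fun k x => Num.sg (f k x)); split => //.
    by move=> x; rewrite big_ord1.
  by move=> x; rewrite big_ord1 sgE.
exists (fun k x => if m n x < `|f n.+1 x| then (if k == n.+1 then Num.sg (f n.+1 x) else 0)
   else (if k == n.+1 then 0 else th k x)).
split=> [k|x|x].
- have mc : measurable_fun setT (fun x => m n x < `|f n.+1 x|).
    apply: measurable_fun_ltr; first exact: meas (Mm n).
    by apply: measurableT_comp => //; exact: meas (Mf n.+1).
  by case: (k == n.+1); apply: measurable_fun_ifT.
- rewrite big_ord_recr /= eqxx; case: ltP => _.
    rewrite big1 ?add0r// => i _; rewrite ltn_eqF ?normr0//; exact: ltn_ord.
  rewrite normr0 addr0 (le_trans _ (th1 x))// le_eqVlt; apply/orP; left; apply/eqP.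
  by apply: eq_bigr => i _; rewrite ltn_eqF//; exact: ltn_ord.
- rewrite big_ord_recr /= eqxx; case: ltP => h.
    rewrite big1 ?add0r => [|i _]; first by rewrite sgE.
    by rewrite ltn_eqF ?mul0r//; exact: ltn_ord.
  rewrite mul0r addr0 -thE.
  by apply: eq_bigr => i _; rewrite ltn_eqF//; exact: ltn_ord.
Qed.

(** * Linear forms in the martingale with total coefficient mass at most one *)

Section linear_form.
Variables (N : nat) (th : nat -> T -> R).
Hypothesis mth : forall k, measurable_fun setT (th k).
Hypothesis th1 : forall x, \sum_(k < N.+1) `|th k x| <= 1.

(** Tail sums of the coefficients: Abel summation pairs each increment [Df j] with [Th j.+1]. *)
Let Th j x := \sum_(k < N.+1 | (j <= k)%N) th k x.

Let ThS j x : (j <= N)%N -> Th j x = th j x + Th j.+1 x.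
Proof.
move=> jN; rewrite /Th (bigD1 (Ordinal (jN : (j < N.+1)%N)))//=; congr (_ + _).
apply: eq_bigl => k; rewrite [RHS]ltn_neqAle andbC; congr (_ && _).
by rewrite eq_sym.
Qed.

Let Th_last x : Th N.+1 x = 0.
Proof. by rewrite /Th big1// => k; rewrite ltnNge -ltnS ltn_ord. Qed.

Let Th1 j x : `|Th j x| <= 1.
Proof.
apply: (le_trans (ler_norm_sum _ _ _)); apply: le_trans (th1 x).
by rewrite big_mkcond; apply: ler_sum => k _; case: ifP.
Qed.

Let mTh j : measurable_fun setT (Th j).
Proof.
rewrite (_ : Th j = fun x => \sum_(k < N.+1) (if (j <= k)%N then th k x else 0)).
  by apply: measurable_sum => k; case: (j <= k)%N.
by apply/funext => x; rewrite /Th big_mkcond.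
Qed.

Let mThw j : measurable_fun setT (fun x => Th j x * w x).
Proof. exact: measurable_funM. Qed.

Let IThw j : I (fun x => Th j x * w x).
Proof.
apply: (integrable_bounded P (c := L)) => // x.
by rewrite normrM (ger0_norm (w0 x)) -[leRHS]mul1r ler_pM.
Qed.

(** Since [|Th k| <= 1], the variable [Th k * w] lies between [- w] and [w]. Below, [g] takes
    [k = j] and [q] takes [k = j.+1]. *)
Let vers j k : exists g, cexp_version P (F j) (fun x => Th k x * w x) g /\
  forall x, `|g x| <= wn j x.
Proof.
have ThwN x : `|Th k x * w x| <= w x.
  by rewrite normrM (ger0_norm (w0 x)) ler_piMl.
have [|||g [vg gw]] := cexp_version_between (sF j) (@FT j) (IThw k) _ _
  (cexp_versionN (sF j) (@FT j) (wnE j)) (wnE j).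
- by move=> x; have := ThwN x; rewrite ler_norml => /andP[].
- by move=> x; have := ThwN x; rewrite ler_norml => /andP[].
- by move=> x; rewrite (le_trans _ (wn0 j x))// oppr_le0.
by exists g; split => // x; rewrite ler_norml.
Qed.

Section versions.
Variables g q : nat -> T -> R.
Hypothesis vg : forall j, cexp_version P (F j) (fun x => Th j x * w x) (g j).
Hypothesis vq : forall j, cexp_version P (F j) (fun x => Th j.+1 x * w x) (q j).
Hypothesis gw : forall j x, `|g j x| <= wn j x.
Hypothesis qw : forall j x, `|q j x| <= wn j x.

Let Mg j : G_meas (F j) (g j). Proof. by case: (vg j). Qed.
Let Mq j : G_meas (F j) (q j). Proof. by case: (vq j). Qed.
Let gv j x : `|g j x| <= v j x. Proof. exact: le_trans (gw j x) (wnv j x). Qed.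
Let qv j x : `|q j x| <= v j x. Proof. exact: le_trans (qw j x) (wnv j x). Qed.
Let gL j x : `|g j x| <= L. Proof. exact: le_trans (gv j x) (vL j x). Qed.
Let qL j x : `|q j x| <= L. Proof. exact: le_trans (qv j x) (vL j x). Qed.

(** Both terms are conditional expectations of the same variable [Th j.+1 * w], at times [j.+1] and
    [j], so this is a martingale difference, which [g j.+1 - g j] need not be. *)
Let Dl j x := g j.+1 x - q j x.
Let D j x := s j.+1 x * (Dl j x ^+ 2 / v j.+1 x).
Let V j x := s j x * (g j x ^+ 2 / v j x + 2 * v j x).

Let MDl j : G_meas (F j.+1) (Dl j).
Proof. by apply: (G_measB FF) => //; exact: mono (leqnSn j) (Mq j). Qed.

Let Dlv j x : `|Dl j x| <= 2 * v j.+1 x.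
Proof.
rewrite (le_trans (ler_normB _ _))// mulr_natl mulr2n lerD//.
exact: le_trans (qv j x) (running_maxS _ _ _).
Qed.

Let DlL j x : `|Dl j x| <= 2 * L.
Proof. by apply: le_trans (Dlv j x) _; rewrite ler_wpM2l. Qed.

Let DE j x : 0 <= D j x <= 4 * (s j.+1 x * v j.+1 x).
Proof.
have /andP[h1 h2] : 0 <= Dl j x ^+ 2 / v j.+1 x <= 2 ^+ 2 * v j.+1 x.
  exact: sqr_div_le.
rewrite -natrX in h2.
by rewrite mulr_ge0//= mulrCA ler_wpM2l.
Qed.

Let ID j : I (D j).
Proof.
apply: (integrable_dominated (c := 4) (Iv j.+1 (Is j.+1))).
  apply: (@meas j.+1); apply: (G_measM FF) => //; apply: (G_measM FF).
    exact: (G_measX FF).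
  exact: (G_measV FF).
by move=> x; have /andP[? ?] := DE j x; rewrite !ger0_norm// mulr_ge0.
Qed.

Let VE j x : 0 <= V j x <= 3 * (s j x * v j x).
Proof.
have gv' : `|g j x| <= 1 * v j x by rewrite mul1r.
have /andP[h1 h2] : 0 <= g j x ^+ 2 / v j x <= 1 ^+ 2 * v j x by exact: sqr_div_le.
rewrite expr1n mul1r in h2.
apply/andP; split; first by rewrite mulr_ge0// addr_ge0// mulr_ge0.
by rewrite mulrCA ler_wpM2l//; lra.
Qed.

Let IV j : I (V j).
Proof.
apply: (integrable_dominated (c := 3) (Iv j (Is j))).
  apply: (@meas j); apply: (G_measM FF) => //; apply: (G_measD FF).
    by apply: (G_measM FF); [exact: (G_measX FF)|exact: (G_measV FF)].
  by apply: (G_measM FF) => //; apply/G_measP => //; exact: measurable_cst.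
by move=> x; have /andP[? ?] := VE j x; rewrite !ger0_norm// mulr_ge0.
Qed.

(* One step forward in time, [g j.+1] against [q j]. *)
Let Z j x := s j x * (q j x / v j x).
(* The change from [g j] to [q j] at a fixed time only costs [th j]. *)
Let Y j x := s j x * ((g j x + q j x) / v j x).

Let MZ j : G_meas (F j) (Z j).
Proof.
by apply: (G_measM FF) => //; apply: (G_measM FF) => //; exact: (G_measV FF).
Qed.

Let MY j : G_meas (F j) (Y j).
Proof.
apply: (G_measM FF) => //; apply: (G_measM FF); last exact: (G_measV FF).
exact: (G_measD FF).
Qed.

Let Zs j x : `|Z j x| <= 1 * `|s j x|.
Proof.
rewrite normrM mulrC ler_wpM2r//; apply: normr_div_le => //.
by rewrite mul1r.
Qed.

Let Ys j x : `|Y j x| <= 2 * `|s j x|.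
Proof.
rewrite normrM mulrC ler_wpM2r//; apply: normr_div_le => //.
by rewrite (le_trans (ler_normD _ _))// mulr_natl mulr2n lerD.
Qed.

Let IZ j : I (Z j).
Proof. exact: (integrable_dominated (Is j) (meas (@MZ j)) (@Zs j)). Qed.
Let IY j : I (Y j).
Proof. exact: (integrable_dominated (Is j) (meas (@MY j)) (@Ys j)). Qed.

Let pull (j k : nat) (X u : T -> R) c : G_meas (F j) X -> I X ->
  cexp_version P (F j) (fun x => Th k x * w x) u -> (forall x, `|u x| <= c) ->
  [/\ I (fun x => X x * u x), I (fun x => X x * (Th k x * w x)) &
  Ex (fun x => X x * u x) = Ex (fun x => X x * (Th k x * w x))].
Proof.
move=> MX IX vu uc.
have h1 : I (fun x => X x * u x).
  by apply: (integrable_mul_bounded (c := c)) => //; case: vu => _ /meas.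
have h2 : I (fun x => X x * (Th k x * w x)).
  apply: (integrable_mul_bounded (c := L)) => // x.
  by rewrite normrM (ger0_norm (w0 x)) -[leRHS]mul1r ler_pM.
by split => //; exact: (cexp_version_pull_out (sF j) (@FT j) vu MX h2 h1).
Qed.

Let forward j : I (fun x => Z j x * Dl j x) /\ Ex (fun x => Z j x * Dl j x) = 0.
Proof.
have [i1 i2 e1] := pull (mono (leqnSn j) (@MZ j)) (IZ j) (vg j.+1) (@gL j.+1).
have [i3 i4 e2] := pull (@MZ j) (IZ j) (vq j) (@qL j).
have -> : (fun x => Z j x * Dl j x) = (fun x => Z j x * g j.+1 x - Z j x * q j x).
  by apply/funext => x; rewrite mulrBr.
split; last by rewrite RintegralB// e1 e2 subrr.
by have := integrableB measurableT i1 i3; exact: eq_integrable.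
Qed.

Let sthw n j := fun x => s n x * (`|th j x| * w x).

Let Isthw n j : (j <= N)%N -> I (sthw n j).
Proof.
move=> jN; apply: (integrable_mul_bounded (c := L)) => //.
  by apply: measurable_funM => //; apply: measurableT_comp.
move=> x; rewrite normrM normr_id (ger0_norm (w0 x)) -[leRHS]mul1r ler_pM//.
apply: le_trans (th1 x); rewrite (bigD1 (Ordinal (jN : (j < N.+1)%N)))//= lerDl.
exact: sumr_ge0.
Qed.

(** Integrated against [Y j], the difference [g j - q j] becomes [(Th j - Th j.+1) * w = th j * w],
    and [|Y j| <= 2 * s j <= 2 * s N]. Having [s N] for every [j] lets the costs be summed through
    [\sum_j |th j| <= 1]. *)
Let backward j : (j <= N)%N -> I (fun x => Y j x * (g j x - q j x)) /\
  Ex (fun x => Y j x * (g j x - q j x)) <= 2 * Ex (sthw N j).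
Proof.
move=> jN.
have [i1 i2 e1] := pull (@MY j) (IY j) (vg j) (@gL j).
have [i3 i4 e2] := pull (@MY j) (IY j) (vq j) (@qL j).
have -> : (fun x => Y j x * (g j x - q j x)) = (fun x => Y j x * g j x - Y j x * q j x).
  by apply/funext => x; rewrite mulrBr.
split; first by have := integrableB measurableT i1 i3; exact: eq_integrable.
rewrite RintegralB// e1 e2 -RintegralB// -RintegralZl//; last exact: Isthw.
apply: le_Rintegral => //.
- by have := integrableB measurableT i2 i4; exact: eq_integrable.
- by have := integrableZl measurableT 2 (Isthw N jN); exact: eq_integrable.
move=> x _; rewrite -mulrBr -mulrBl ThS// addrK.
rewrite (le_trans (ler_norm _))// normrM [`|th j x * _|]normrM (ger0_norm (w0 x)).
rewrite mulrA ler_wpM2r ?mulr_ge0// (le_trans (Ys j x))// (ger0_norm (s0 j x)).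
by rewrite ler_wpM2l// (square_fun_homo f x).
Qed.

(** The potential [V] telescopes. [davis_step] leads from [q n] to [g n.+1], with weights [s] and
    majorants [v]; starting from the potential at [q n] instead of [g n] costs [s n * (g n ^+ 2 - q
    n ^+ 2) / v n = Y n * (g n - q n)], which [backward] controls. *)
Let Rintegral_sum_D n : (n <= N)%N ->
  \sum_(j < n) Ex (D j) <= 2 * Ex (V n) + 4 * \sum_(j < n) Ex (sthw N j).
Proof.
elim: n => [_|n ih nN].
  rewrite !big_ord0 mulr0 addr0 mulr_ge0// Rintegral_ge0// => x _.
  by case/andP: (VE 0 x).
rewrite !big_ord_recr/=; have {}ih := ih (ltnW nN).
suff : Ex (D n) <= 2 * (Ex (V n.+1) - Ex (V n)) + 4 * Ex (sthw N n) by lra.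
have [IZD EZD] := forward n.
have [IYD EYD] := backward (ltnW nN).
have IVV : I (fun x => V n.+1 x - V n x).
  by have := integrableB measurableT (IV n.+1) (IV n); exact: eq_integrable.
have I2Z : I (fun x => 2 * (Z n x * Dl n x)).
  by have := integrableZl measurableT 2 IZD; exact: eq_integrable.
have I1 : I (fun x => V n.+1 x - V n x - 2 * (Z n x * Dl n x)).
  by have := integrableB measurableT IVV I2Z; exact: eq_integrable.
have I2 : I (fun x => V n.+1 x - V n x - 2 * (Z n x * Dl n x) + Y n x * (g n x - q n x)).
  by have := integrableD measurableT I1 IYD; exact: eq_integrable.
apply: (@le_trans _ _ (2 * Ex (fun x =>
    V n.+1 x - V n x - 2 * (Z n x * Dl n x) + Y n x * (g n x - q n x)))).
  rewrite -RintegralZl//; apply: le_Rintegral => //; first exact: ID.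
    by have := integrableZl measurableT 2 I2; exact: eq_integrable.
  move=> x _; apply: (le_trans (davis_step (qv n x) (gv n.+1 x)
    (running_maxS wn n x) (s0 n x) (square_funS f n x))).
  rewrite ler_pM2l// /V /Y /Z /Dl le_eqVlt; apply/orP; left; apply/eqP.
  ring.
rewrite RintegralD// !RintegralB// RintegralZl// EZD.
lra.
Qed.

(** Conditioning at time [n.+1] replaces [Th n.+1 * w] by [g n.+1], and [q n] can be subtracted
    because it is orthogonal to the increment. In the sum of the bounds from [increment_young], the
    fixed final weight [v N] makes the differences of [s] telescope. *)
Let diff_young n : (n <= N)%N ->
  2 * \sum_(j < n) Ex (fun x => Df j x * (Th j.+1 x * w x)) <=
  2 * Ex (fun x => s n x * v N x) + \sum_(j < n) Ex (D j).
Proof.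
elim: n => [_|n ih nN].
  rewrite !big_ord0 mulr0 addr0 mulr_ge0// Rintegral_ge0// => x _.
  exact: mulr_ge0.
rewrite !big_ord_recr/=; have {}ih := ih (ltnW nN).
suff : 2 * Ex (fun x => Df n x * (Th n.+1 x * w x)) <=
  2 * (Ex (fun x => s n.+1 x * v N x) - Ex (fun x => s n x * v N x)) + Ex (D n) by lra.
have IDf : I (fun x => Df n x).
  by have := integrableB measurableT (@If n.+1) (@If n); exact: eq_integrable.
have MDf : G_meas (F n.+1) (fun x => Df n x).
  by apply: (G_measB FF) => //; exact: mono (leqnSn n) (Mf n).
have [i1 i2 <-] := pull MDf IDf (vg n.+1) (@gL n.+1).
have [i3 e3] := Rintegral_martingale_diff (@Mq n) (@qL n).
have e4 : Ex (fun x => Df n x * g n.+1 x) = Ex (fun x => Df n x * Dl n x).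
  have -> : (fun x => Df n x * Dl n x) = (fun x => Df n x * g n.+1 x - q n x * Df n x).
    by apply/funext => x; rewrite /Dl mulrBr [q n x * _]mulrC.
  by rewrite RintegralB// e3 subr0.
have IDD : I (fun x => Df n x * Dl n x).
  by apply: (integrable_mul_bounded (c := 2 * L)) => //; exact: meas (@MDl n).
have Is1 : I (fun x => s n.+1 x * v N x - s n x * v N x).
  by have := integrableB measurableT (Iv N (Is n.+1)) (Iv N (Is n)); exact: eq_integrable.
have I2s : I (fun x => 2 * (s n.+1 x * v N x - s n x * v N x)).
  by have := integrableZl measurableT 2 Is1; exact: eq_integrable.
rewrite e4 -RintegralB; [|exact: measurableT|exact: Iv|exact: Iv].
rewrite -!RintegralZl// -RintegralD//; last exact: ID.
apply: le_Rintegral => //.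
- by have := integrableZl measurableT 2 IDD; exact: eq_integrable.
- by have := integrableD measurableT I2s (ID n); exact: eq_integrable.
move=> x _; rewrite -mulrBl; apply: increment_young => //.
- exact: square_funS.
- by rewrite sqr_square_funS addrAC subrr add0r.
- by apply: (running_max_homo wn x).
Qed.

(** The boundary terms of the Abel summation vanish: [f 0 = 0] almost everywhere and [Th N.+1 = 0].
    Twice the left side is at most [2 + 2 * 3 + 4 = 12] times the integral of [s N * v N], the
    summands coming from [diff_young], from [V] and from [backward]. *)
Lemma Rintegral_linear_form_le :
  Ex (fun x => (\sum_(k < N.+1) th k x * f k x) * w x) <=
  6 * Ex (fun x => s N x * v N x).
Proof.
have abel n x : (n <= N.+1)%N -> \sum_(k < n) th k x * f k x =
    f 0 x * Th 0 x + \sum_(j < n) Df j x * Th j.+1 x - f n x * Th n x.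
  elim: n => [_|n ih nN]; first by rewrite !big_ord0 addr0 subrr.
  rewrite !big_ord_recr/= ih ?(ltnW nN)// (@ThS n x nN); ring.
have sumE x : (\sum_(k < N.+1) th k x * f k x) * w x =
    f 0 x * (Th 0 x * w x) + \sum_(j < N) Df j x * (Th j.+1 x * w x).
  rewrite abel// big_ord_recr/= Th_last !mulr0 subr0 addr0 mulrDl mulrA; congr (_ + _).
  by rewrite mulr_suml; apply: eq_bigr => j _; rewrite mulrA.
have Thc k x : `|Th k x * w x| <= L.
  by rewrite normrM (ger0_norm (w0 x)) -[leRHS]mul1r ler_pM.
have I0 : I (fun x => f 0 x * (Th 0 x * w x)).
  by apply: (integrable_mul_bounded (c := L)).
have IDf j : I (fun x => Df j x * (Th j.+1 x * w x)).
  apply: (integrable_mul_bounded (c := L)) => //.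
  by have := integrableB measurableT (@If j.+1) (@If j); exact: eq_integrable.
have E0 : Ex (fun x => f 0 x * (Th 0 x * w x)) = 0.
  rewrite /Rintegral (@ae_eq_integral _ _ _ P setT (cst 0%E))//=.
  - by rewrite integral0.
  - exact: measurable_int I0.
  - case: mf => f0 _ _ _; apply: filterS f0 => x f0 _ /=.
    by rewrite f0 mul0r.
have ESum : Ex (fun x => \sum_(j < N) Df j x * (Th j.+1 x * w x)) =
    \sum_(j < N) Ex (fun x => Df j x * (Th j.+1 x * w x)).
  rewrite /Rintegral; under eq_integral do rewrite -sumEFin.
  rewrite integral_sum//; last by move=> j; exact: (IDf j).
  rewrite -sum_fine// => j _; apply: integrable_fin_num => //; exact: (IDf j).
have ISum : I (fun x => \sum_(j < N) Df j x * (Th j.+1 x * w x)).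
  have : P.-integrable setT (fun x => (\sum_(j < N) (Df j x * (Th j.+1 x * w x))%:E)%E).
    by apply: integrable_sum => // i _; exact: (IDf i).
  by apply: eq_integrable => // x _ /=; rewrite sumEFin.
under eq_Rintegral do rewrite sumE.
rewrite RintegralD// E0 add0r ESum.
have h1 := diff_young (leqnn N).
have h2 := Rintegral_sum_D (leqnn N).
have h3 : Ex (V N) <= 3 * Ex (fun x => s N x * v N x).
  rewrite -RintegralZl//; last exact: Iv.
  apply: le_Rintegral => //; first exact: IV.
    by have := integrableZl measurableT 3 (Iv N (Is N)); exact: eq_integrable.
  by move=> x _; case/andP: (VE N x).
have Isthw' (j : 'I_N) : I (sthw N j) by apply: Isthw; exact/ltnW/ltn_ord.
have h4 : \sum_(j < N) Ex (sthw N j) <= Ex (fun x => s N x * w x).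
  have -> : \sum_(j < N) Ex (sthw N j) = Ex (fun x => \sum_(j < N) sthw N j x).
    rewrite /Rintegral; under [in RHS]eq_integral do rewrite -sumEFin.
    rewrite integral_sum//.
    by rewrite sum_fine// => j _; apply: integrable_fin_num => //; exact: (Isthw' j).
  apply: le_Rintegral => //; [|exact: Iw|].
    have : P.-integrable setT (fun x => (\sum_(j < N) (sthw N j x)%:E)%E).
      by apply: integrable_sum => // i _; exact: (Isthw' i).
    by apply: eq_integrable => // x _ /=; rewrite sumEFin.
  move=> x _; rewrite /sthw -mulr_sumr ler_wpM2l// -mulr_suml.
  rewrite -[leRHS]mul1r ler_wpM2r// (le_trans _ (th1 x))//.
  by rewrite big_ord_recr/= lerDl.
have h5 := Rintegral_weight_le (Ms N) (Is N) (s0 N).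
lra.
Qed.

End versions.

Lemma Rintegral_linear_form_weight :
  Ex (fun x => (\sum_(k < N.+1) th k x * f k x) * w x) <=
  6 * Ex (fun x => s N x * v N x).
Proof.
have [g Hg] := choice (fun j => vers j j).
have [q Hq] := choice (fun j => vers j j.+1).
by apply: (@Rintegral_linear_form_le g q) => j; case: (Hg j) (Hq j) => ? ? [].
Qed.

End linear_form.

Lemma weighted_max_le_square n :
  Ex (fun x => m n x * w x) <= 6 * Ex (fun x => s n x * v n x).
Proof.
have [th [mth th1 thE]] := running_max_linearization n.
rewrite (_ : (fun x => _) = fun x => (\sum_(k < n.+1) th k x * f k x) * w x).
  exact: Rintegral_linear_form_weight.
by apply/funext => x; rewrite thE.
Qed.

End weighted_davis.

(** * Lower integrals and conjugate functions *)

Section lower_integral.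
Context {d : measure_display} {T : measurableType d} {R : realType}.
Variable P : probability T R.

Lemma cvge_le_sup (u : nat -> \bar R) (l : \bar R) :
  u n @[n --> \oo] --> l -> (l <= ereal_sup (range u))%E.
Proof.
move=> ul; rewrite -(cvg_lim (@ereal_hausdorff R) ul); apply: lime_le.
  by apply/cvg_ex; exists l.
by apply: nearW => n; apply: ereal_sup_ubound; exists n.
Qed.

Lemma nd_cvge_ge (u : nat -> \bar R) (l : \bar R) n :
  {homo u : k m / (k <= m)%N >-> (k <= m)%E} ->
  u n @[n --> \oo] --> l -> (u n <= l)%E.
Proof.
move=> nd ul; rewrite -(cvg_lim (@ereal_hausdorff R) ul).
rewrite (cvg_lim (@ereal_hausdorff R) (ereal_nondecreasing_cvgn nd)).
by apply: ereal_sup_ubound; exists n.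
Qed.

(** Monotone convergence for an [f] that may be nonmeasurable: the limit of the [g n] dominates [f],
    and the integral of nonnegative functions is monotone without measurability. *)
Lemma integral_le_sup (g : nat -> T -> \bar R) (f : T -> \bar R) c :
  (forall n, measurable_fun setT (g n)) -> (forall n x, 0 <= g n x)%E ->
  (forall x, {homo g ^~ x : n m / (n <= m)%N >-> (n <= m)%E}) ->
  (forall x, 0 <= f x)%E -> (forall x, f x <= ereal_sup (range (g ^~ x)))%E ->
  (forall n, \int[P]_x g n x <= c)%E -> (\int[P]_x f x <= c)%E.
Proof.
move=> mg g0 ndg f0 fg gc.
apply: (@le_trans _ _ (\int[P]_x limn (g ^~ x))%E).
  apply: le_integral_lower => // x; apply: le_trans (fg x) _.
  rewrite le_eqVlt; apply/orP; left; apply/eqP/esym/cvg_lim => //.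
  exact: ereal_nondecreasing_cvgn.
have cv := @cvg_monotone_convergence _ _ _ P setT measurableT g mg
  (fun n x _ => g0 n x) (fun x _ => ndg x).
rewrite -(cvg_lim (@ereal_hausdorff R) cv); apply: lime_le.
  by apply/cvg_ex; eexists; exact: cv.
exact: nearW.
Qed.

Import HBNNSimple.

Lemma nnsfun_approximation (f : T -> \bar R) :
  measurable_fun setT f -> (forall x, 0 <= f x)%E ->
  exists t : nat -> {nnsfun T >-> R},
  [/\ forall x, {homo (fun n => t n x) : n m / (n <= m)%N >-> n <= m},
      forall x, (t n x)%:E @[n --> \oo] --> f x
    & forall n x, ((t n x)%:E <= f x)%E].
Proof.
move=> mf f0; exists (nnsfun_approx measurableT mf).
have nd x : {homo (fun n => nnsfun_approx measurableT mf n x) : n m / (n <= m)%N >-> n <= m}.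
  by move=> n m nm; have /lefP := nd_nnsfun_approx measurableT mf nm; exact.
have cv x : (nnsfun_approx measurableT mf n x)%:E @[n --> \oo] --> f x.
  exact: (cvg_nnsfun_approx measurableT mf (fun y _ => f0 y)).
split => // n x.
apply: (nd_cvge_ge (u := fun n => (nnsfun_approx measurableT mf n x)%:E)); last exact: cv.
by move=> ? ? ?; rewrite lee_fin nd.
Qed.

End lower_integral.

(** * Lower type, the conjugate function and Young's inequality *)

Section orlicz.
Context {d : measure_display} {T : measurableType d} {R : realType}.
Variable P : probability T R.
Variable phi : T -> R -> R.
Hypothesis phiMO : MO_function P phi.
Variables (p C : R).
Hypothesis p1 : 1 < p.
Hypothesis C0 : 0 < C.
Hypothesis phi_lower : forall x s t, 0 < s -> s < 1 -> 0 <= t ->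
  phi x (s * t) <= C * s `^ p * phi x t.

Let phi_nd x s t : 0 <= s -> s <= t -> phi x s <= phi x t.
Proof. by case: phiMO => H _; exact: H. Qed.
Let phi0 x : phi x 0 = 0. Proof. by case: phiMO => _ []. Qed.
Let phi_ge0 x t : 0 <= t -> 0 <= phi x t.
Proof. by move=> t0; rewrite -(phi0 x) phi_nd. Qed.

Lemma lower_type_linear x s t : 0 < s -> s < 1 -> 0 <= t ->
  phi x (s * t) <= C * s * phi x t.
Proof.
move=> s0 s1 t0; apply: le_trans (phi_lower x s0 s1 t0) _.
rewrite ler_wpM2r ?phi_ge0// ler_wpM2l ?(ltW C0)//.
rewrite -[leRHS]powRr1 ?(ltW s0)//.
by apply: ger_powR => //; [rewrite s0 ltW|exact: ltW].
Qed.

Lemma conj_fun_young x u t : 0 < u -> ((u * t - phi x u)%:E <= conj_fun phi x t)%E.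
Proof. by move=> u0; apply: ereal_sup_ubound; exists u. Qed.

(** The supremum runs over [u > 0], so [u = 0] cannot be inserted; instead [phi x u] tends to 0 with
    [u] by the lower type. *)
Lemma conj_fun_ge0 x t : 0 <= t -> (0 <= conj_fun phi x t)%E.
Proof.
move=> t0; apply/lee_addgt0Pr => e e0.
pose B := C * phi x 1.
have B0 : 0 <= B by rewrite mulr_ge0 ?(ltW C0)// phi_ge0.
(* This gives [B * u <= e]; the summand 1 guards against [B = 0], and [2^-1] keeps [u] below 1. *)
pose u := Num.min 2^-1 (e / (B + 1)).
have u0 : 0 < u by rewrite lt_min invr_gt0 ltr0n divr_gt0// ltr_pwDr.
have u1 : u < 1 by rewrite gt_min; apply/orP; left; lra.
have : phi x u <= e.
  rewrite -[u]mulr1 (le_trans (lower_type_linear x u0 u1 ler01))//.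
  rewrite mulrAC -/B (@le_trans _ _ (B * (e / (B + 1))))//.
    by rewrite ler_wpM2l// ge_min lexx orbT.
  by rewrite mulrA ler_pdivrMr ?ltr_pwDr// mulrC ler_wpM2l ?(ltW e0)// lerDl.
move=> phie; apply: (@le_trans _ _ ((u * t - phi x u)%:E + e%:E)%E).
  by rewrite -EFinD lee_fin; have := mulr_ge0 (ltW u0) t0; lra.
by rewrite leeD2r// conj_fun_young.
Qed.

(* Only the linear consequence [phi x t / t <= C * phi x u / u] ([t <= u]) of
   the lower type is needed: it makes [u * h - phi x u] nonpositive beyond [t]. *)
Lemma conj_fun_le x t h : 0 <= t -> 0 <= h ->
  h <= Num.min 1 C^-1 * phi x t / t -> (conj_fun phi x h <= (t * h)%:E)%E.
Proof.
move=> t0 h0 hphi; apply: ge_ereal_sup => _ [u /= u0 <-]; rewrite lee_fin.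
have [ut|tu] := leP u t.
  by have := phi_ge0 x (ltW u0); have := ler_wpM2r h0 ut; lra.
have th : 0 <= t * h by exact: mulr_ge0.
suff : u * h <= phi x u by lra.
(* For [t = 0] the quotient by [t] is 0, so the hypothesis forces [h = 0]. *)
move: t0; rewrite le_eqVlt => /predU1P[tE|tp].
  have -> : h = 0.
    by apply/eqP; rewrite eq_le h0 andbT (le_trans hphi)// -tE phi0 mulr0 mul0r.
  by rewrite mulr0 phi_ge0// ltW.
have tu1 : t / u < 1 by rewrite ltr_pdivrMr// mul1r.
have := lower_type_linear x (divr_gt0 tp u0) tu1 (ltW u0).
rewrite divfK ?gt_eqF// => phit.
rewrite -ler_pdivlMl//; apply: (le_trans hphi).
rewrite -mulrA; apply: (@le_trans _ _ (C^-1 * (phi x t / t))).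
  by rewrite ler_wpM2r ?ge_min ?lexx ?orbT// divr_ge0 ?phi_ge0// ltW.
rewrite ler_pdivrMl// ler_pdivrMr// (le_trans phit)//.
by rewrite le_eqVlt; apply/orP; left; apply/eqP; field; rewrite gt_eqF.
Qed.

Import HBNNSimple.

(** [phi] is measurable in [x] for each fixed second argument, and a simple function takes finitely
    many values, so a preimage is a finite union over these values. *)
Lemma measurable_MO_nnsfun (t : {nnsfun T >-> R}) : measurable_fun setT (fun x => phi x (t x)).
Proof.
move=> _ B mB; rewrite setTI.
rewrite (_ : _ @^-1` B = \bigcup_(y in range t) (t @^-1` [set y] `&` phi ^~ y @^-1` B)).
  apply: fin_bigcup_measurable; first exact: fimfunP.
  move=> _ [x _ <-]; apply: measurableI; first exact: measurable_sfunP.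
  rewrite -[X in measurable X]setTI.
  by case: phiMO => _ [_ _ mphi _ _]; exact: mphi.
apply/seteqP; split=> [x Bx|x [y _ [/= <-]]//].
by exists (t x).
Qed.

Let Phi := Phi_ext (fun x t => (phi x t)%:E).

Lemma Phi_ge0 x (y : \bar R) : (0 <= y)%E -> (0 <= Phi x y)%E.
Proof. by case: y => //= r; rewrite !lee_fin; exact: phi_ge0. Qed.

Lemma Phi_nd x t (y : \bar R) : 0 <= t -> (t%:E <= y)%E -> ((phi x t)%:E <= Phi x y)%E.
Proof. by move=> t0; case: y => [r| |]//=; rewrite ?leey// !lee_fin; exact: phi_nd. Qed.

(** Young's inequality for [Y / lam] and [W / rho], each of modular at most 1, yields [1 + 1]. As
    the modular integrands may be nonmeasurable, [Y / lam] is first replaced by simple functions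
    increasing to it. *)
Lemma integral_young (Y : T -> \bar R) (W : T -> R) lam rho :
  measurable_fun setT Y -> (forall x, 0 <= Y x)%E ->
  measurable_fun setT W -> (forall x, 0 <= W x) -> 0 < lam -> 0 < rho ->
  (\int[P]_x Phi x (`|Y x| * (lam^-1)%:E) <= 1)%E ->
  (\int[P]_x Phi_ext (conj_fun phi) x (`|(W x)%:E| * (rho^-1)%:E) <= 1)%E ->
  (\int[P]_x (Y x * (W x)%:E) <= (2 * (lam * rho))%:E)%E.
Proof.
move=> mY Y0 mW W0 lam0 rho0 iY iW.
have lamV : 0 <= lam^-1 by rewrite invr_ge0 ltW.
have rhoV : 0 <= rho^-1 by rewrite invr_ge0 ltW.
pose Y' x := (`|Y x| * (lam^-1)%:E)%E.
pose W' x := W x * rho^-1.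
have mY' : measurable_fun setT Y'.
  by apply: emeasurable_funM => //; exact: measurableT_comp.
have mW' : measurable_fun setT W' by exact: measurable_funM.
have Y'0 x : (0 <= Y' x)%E by rewrite mule_ge0.
have W'0 x : 0 <= W' x by rewrite mulr_ge0.
have [t [ndt tY' tleY']] := nnsfun_approximation mY' Y'0.
have t0 n x : 0 <= t n x by [].
have step n : (\int[P]_x (t n x * W' x)%:E <= 2%:E)%E.
  have mphit := measurable_MO_nnsfun (t n).
  (* A measurable minorant of [conj_fun phi x (W' x)]; its measurability lets the integral of the
     sum split. *)
  pose r x := Num.max (t n x * W' x - phi x (t n x)) 0.
  have mr : measurable_fun setT r.
    apply: measurable_maxr => //; apply: measurable_funB => //.
    exact: measurable_funM.
  apply: (@le_trans _ _ (\int[P]_x ((phi x (t n x))%:E + (r x)%:E))%E).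
    apply: le_integral_lower => x; first by rewrite lee_fin mulr_ge0.
    by rewrite -EFinD lee_fin /r -lerBlDl le_max lexx.
  rewrite ge0_integralD//=; last 4 first.
    by move=> x _; rewrite lee_fin phi_ge0.
    exact/measurable_EFinP.
    by move=> x _; rewrite lee_fin le_max lexx orbT.
    exact/measurable_EFinP.
  rewrite [leRHS](_ : _ = 1 + 1)%E; last by rewrite -EFinD.
  apply: leeD.
    apply: le_trans iY; apply: le_integral_lower => x; first by rewrite lee_fin phi_ge0.
    exact: Phi_nd.
  apply: le_trans iW; apply: le_integral_lower => x; first by rewrite lee_fin le_max lexx orbT.
  rewrite gee0_abs ?lee_fin// -EFinM /= /r EFin_max ge_max -/(W' x) conj_fun_ge0// andbT.
  have [tp|] := ltP 0 (t n x); first exact: conj_fun_young.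
  move=> tn; have -> : t n x = 0 by apply/eqP; rewrite eq_le tn t0.
  by rewrite mul0r phi0 subrr conj_fun_ge0.
have main : (\int[P]_x (Y' x * (W' x)%:E) <= 2%:E)%E.
  apply: (integral_le_sup (g := fun n x => (t n x * W' x)%:E)) => //.
  - by move=> n; apply/measurable_EFinP; exact: measurable_funM.
  - by move=> n x; rewrite lee_fin mulr_ge0.
  - by move=> x n m nm; rewrite lee_fin ler_wpM2r// ndt.
  - by move=> x; rewrite mule_ge0// lee_fin.
  - move=> x; apply: cvge_le_sup; under eq_fun do rewrite EFinM.
    by apply: cvgeZr; last exact: tY'.
rewrite [X in (X <= _)%E](_ : _ = (lam * rho)%:E * \int[P]_x (Y' x * (W' x)%:E))%E.
  rewrite (mulrC 2) [leRHS]EFinM; apply: lee_wpmul2l => //.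
  by rewrite lee_fin mulr_ge0// ltW.
rewrite -ge0_integralZl//; last 3 first.
- by apply: emeasurable_funM => //; exact/measurable_EFinP.
- by move=> x _; rewrite mule_ge0// lee_fin.
- by rewrite lee_fin mulr_ge0// ltW.
apply: eq_integral => x _; rewrite /Y' /W' gee0_abs//.
rewrite -[(_ * (lam^-1)%:E * _)%E]muleA.
rewrite (muleCA (lam * rho)%:E) -!EFinM.
by congr (_ * _%:E)%E; field; rewrite !gt_eqF.
Qed.

End orlicz.

(** * Maximal and square functions as limits over finite horizons *)

Section running_limits.
Context {d : measure_display} {T : measurableType d} {R : realType}.
Implicit Type h : nat -> T -> R.

Lemma maxf_ge0 h x : (0 <= maxf h x)%E.
Proof.
apply: (@le_trans _ _ (`|h 0 x|)%:E); first by rewrite lee_fin.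
by apply: ereal_sup_ubound; exists 0%N.
Qed.

Lemma running_max_le_maxf h n x : ((running_max h n x)%:E <= maxf h x)%E.
Proof.
elim: n => [|n ih]; first by apply: ereal_sup_ubound; exists 0%N.
by rewrite /= EFin_max ge_max ih/=; apply: ereal_sup_ubound; exists n.+1.
Qed.

Lemma cvg_running_max h x : (running_max h n x)%:E @[n --> \oo] --> maxf h x.
Proof.
have nd : {homo (fun n => (running_max h n x)%:E) : n m / (n <= m)%N >-> (n <= m)%E}.
  by move=> n m nm; rewrite lee_fin running_max_homo.
have -> : maxf h x = ereal_sup (range (fun n => (running_max h n x)%:E)).
  apply/eqP; rewrite eq_le; apply/andP; split.
    apply: ge_ereal_sup => _ [n _ <-].
    apply: (@le_trans _ _ (running_max h n x)%:E); last by apply: ereal_sup_ubound; exists n.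
    by rewrite lee_fin running_max_ge.
  by apply: ge_ereal_sup => _ [n _ <-]; exact: running_max_le_maxf.
exact: ereal_nondecreasing_cvgn.
Qed.

Lemma sqf_ge0 h x : (0 <= sqf h x)%E.
Proof. by rewrite /sqf; case: (limn _) => //= r; rewrite lee_fin sqrtr_ge0. Qed.

Lemma cvg_square_fun h x : (square_fun h n x)%:E @[n --> \oo] --> sqf h x.
Proof.
pose a n := ((h n x - h n.-1 x) ^+ 2)%:E.
pose u n := (\sum_(1 <= k < n) a k)%E.
(* The series in [sqf] starts at index 1 with differences to the predecessor, whence the shift by
   one against [square_fun]. *)
have uE n : u n.+1 = (square_fun h n x ^+ 2)%:E.
  by rewrite /u big_add1/= big_mkord sqr_square_fun -sumEFin.
have ucv : u n.+1 @[n --> \oo] --> limn u.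
  rewrite (cvg_shiftS u).
  by apply: is_cvg_nneseries => n _ _; rewrite lee_fin sqr_ge0.
have s2cv : (square_fun h n x ^+ 2)%:E @[n --> \oo] --> limn u.
  by under eq_fun do rewrite -uE.
have lim0 : (0 <= limn u)%E.
  by apply: nneseries_ge0 => n _ _; rewrite lee_fin sqr_ge0.
rewrite /sqf -/u -/(limn u); move: lim0 s2cv.
case: (limn u) => [r r0 s2cv|_ s2cv|//].
  have -> : (fun n => (square_fun h n x)%:E) =
      EFin \o (fun n => Num.sqrt (square_fun h n x ^+ 2)).
    by apply/funext => n /=; rewrite sqrtr_sqr ger0_norm ?square_fun_ge0.
  apply: cvg_EFin; first exact: nearW.
  apply: (continuous_cvg _ (@sqrt_continuous R r)).
  by have /fine_cvgP[] := s2cv.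
(* Infinite sum: for [A >= 0], [square_fun] reaches [A] as soon as its square reaches [A ^+ 2]. *)
apply/cvgeryP/cvgryPge => A.
move/cvgeryP/cvgryPge/(_ (A ^+ 2)) : s2cv; apply: filterS => n.
have s0 := square_fun_ge0 h n x.
have [A0|A0] := ltP A 0; first by rewrite (le_trans (ltW A0)).
by rewrite ler_pXn2r.
Qed.

End running_limits.

(** * From weighted inequalities to Luxemburg norms *)

Section domination.
Context {d : measure_display} {T : measurableType d} {R : realType}.
Variable P : probability T R.
Variable F : nat -> set (set T).
Hypothesis FF : filtration F.
Variable phi : T -> R -> R.
Hypothesis phiMO : MO_function P phi.
Variables (p C : R).
Hypothesis p1 : 1 < p.
Hypothesis C0 : 0 < C.
Hypothesis phi_lower : forall x s t, 0 < s -> s < 1 -> 0 <= t ->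
  phi x (s * t) <= C * s `^ p * phi x t.
Variable CM : R.
Hypothesis CM0 : 0 < CM.
Hypothesis doob : forall g : T -> R, measurable_fun setT g ->
  (lux P (conj_fun phi) (EFin \o g) < +oo)%E ->
  forall h : nat -> T -> R, (forall n, cexp_version P (F n) g (h n)) ->
  (lux P (conj_fun phi) (maxf h) <= CM%:E * lux P (conj_fun phi) (EFin \o g))%E.

Let phi_nd x s t : 0 <= s -> s <= t -> phi x s <= phi x t.
Proof. by case: phiMO => H _; exact: H. Qed.
Let phi0 x : phi x 0 = 0. Proof. by case: phiMO => _ []. Qed.
Let phi_ge0 x t : 0 <= t -> 0 <= phi x t.
Proof. by move=> t0; rewrite -(phi0 x) phi_nd. Qed.
Let sF n : sigma_algebra setT (F n). Proof. by case: FF. Qed.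
Let FT n : F n `<=` measurable. Proof. by case: FF. Qed.

Lemma lux_lt (Psi : T -> R -> \bar R) (g : T -> \bar R) c :
  (lux P Psi g < c%:E)%E -> exists l, [/\ 0 < l, l < c &
    (\int[P]_x Phi_ext Psi x (`|g x| * (l^-1)%:E) <= 1)%E].
Proof.
by move=> /ereal_inf_lt[_ [l [l0 il] <-]]; rewrite lte_fin => lc; exists l.
Qed.

Lemma weight_versions (w : T -> R) L : measurable_fun setT w -> (forall x, 0 <= w x <= L) ->
  exists wn : nat -> T -> R, (forall n, cexp_version P (F n) w (wn n)) /\
    forall n x, 0 <= wn n x <= L.
Proof.
move=> mw wL; have L0 : 0 <= L by have /andP[] := wL point; exact: le_trans.
have iw : P.-integrable setT (EFin \o w).
  apply: (integrable_bounded P (c := L)) => // x; have /andP[? ?] := wL x.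
  by rewrite ger0_norm.
have H n : exists g, cexp_version P (F n) w g /\ forall x, 0 <= g x <= L.
  apply: (cexp_version_between (sF n) (@FT n) iw _ _
    (cexp_version_cst P (sF n) 0) (cexp_version_cst P (sF n) L)) => // x.
    by case/andP: (wL x).
  by case/andP: (wL x).
have [wn Hwn] := choice H.
by exists wn; split => [n|n x]; case: (Hwn n).
Qed.

(** * Domination under an abstract weighted inequality, so that square and maximal function can
    exchange roles *)

Variables (X Y : T -> \bar R) (A : R).
Hypothesis mX : measurable_fun setT X.
Hypothesis mY : measurable_fun setT Y.
Hypothesis X0 : forall x, (0 <= X x)%E.
Hypothesis Y0 : forall x, (0 <= Y x)%E.
Hypothesis A0 : 0 < A.
Hypothesis dom : forall (w : T -> R) (wn : nat -> T -> R) (L : R),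
  measurable_fun setT w -> (forall x, 0 <= w x <= L) ->
  (forall n x, 0 <= wn n x <= L) -> (forall n, cexp_version P (F n) w (wn n)) ->
  (\int[P]_x (X x * (w x)%:E) <= A%:E * \int[P]_x (Y x * maxf wn x))%E.

Import HBNNSimple.

(** By contradiction: let [J > 1] be the integral. The weight [h] satisfies [conj_fun phi x (h x /
    J) <= t x * h x / J], so its norm for the conjugate function is at most [J]. Then [dom], Young's
    inequality and the maximal inequality give [mu * J <= 4 * A * lam * CM * J], against the choice
    of [mu]. The cut at [L] makes [h] a bounded weight and [J] finite. *)
Lemma integral_test_le1 (t : {nnsfun T >-> R}) (lam mu L : R) :
  0 < lam -> 4 * A * lam * CM < mu -> 0 <= L ->
  (\int[P]_x Phi_ext (fun x t => (phi x t)%:E) x (`|Y x| * (lam^-1)%:E) <= 1)%E ->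
  (forall x, (mu * t x)%:E <= X x)%E ->
  (\int[P]_x (t x * Num.min (Num.min 1 C^-1 * phi x (t x) / t x) L)%:E <= 1)%E.
Proof.
move=> lam0 mu_gt L0 iY tX.
have mu0 : 0 < mu by apply: le_lt_trans mu_gt; rewrite !mulr_ge0// ltW.
have t0 x : 0 <= t x by [].
have eps0 : 0 < Num.min 1 C^-1 by rewrite lt_min ltr01 invr_gt0.
set eps := Num.min 1 C^-1 in eps0 *.
pose h x := Num.min (eps * phi x (t x) / t x) L.
rewrite -/(h _).
have h0 x : 0 <= h x by rewrite le_min L0 divr_ge0// mulr_ge0 ?phi_ge0// ltW.
have hL x : 0 <= h x <= L by rewrite h0/= ge_min lexx orbT.
have mt : measurable_fun setT (t : T -> R) by exact: measurable_funPT.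
have mh : measurable_fun setT h.
  apply: measurable_minr => //; apply: measurable_funM.
    by apply: measurable_funM => //; exact: measurable_MO_nnsfun phiMO t.
  exact: (measurableT_comp (@measurable_invr R) mt).
have [M tM] : exists M, forall x, t x <= M.
  have [M [_ HM]] := simple_bounded t; exists (M + 1) => x.
  have := HM (M + 1); rewrite ltrDl ltr01 => /(_ isT x I)/=.
  by apply: le_trans; rewrite ler_norm.
have ith : P.-integrable setT (EFin \o (fun x => t x * h x)).
  apply: (integrable_bounded P (c := M * L)); first exact: measurable_funM.
  move=> x; rewrite ger0_norm ?mulr_ge0//; apply: ler_pM => //.
  by case/andP: (hL x).
rewrite leNgt; apply/negP.
rewrite (EFin_RintegralE measurableT ith) lte_fin; set J := Rintegral _ _ _ => J1.
have J0 : 0 < J by apply: lt_trans J1.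
(* Here [J > 1] enters: [h / J <= h] stays below the threshold of [conj_fun_le]. *)
have luxh : (lux P (conj_fun phi) (EFin \o h) <= J%:E)%E.
  apply: ereal_inf_lbound; exists J => //; split => //.
  apply: (@le_trans _ _ (\int[P]_x (J^-1 * (t x * h x))%:E)%E).
    apply: le_integral_lower => x; rewrite /= (ger0_norm (h0 x)).
      by apply: (conj_fun_ge0 phiMO p1 C0 phi_lower); rewrite divr_ge0// ltW.
    rewrite mulrCA [J^-1 * _]mulrC.
    apply: (conj_fun_le phiMO p1 C0 phi_lower) => //; first by rewrite divr_ge0// ltW.
    apply: (@le_trans _ _ (h x)); last by rewrite ge_min lexx.
    by rewrite ler_piMr// invf_le1// ltW.
  under eq_integral do rewrite EFinM.
  rewrite integralZl//= (EFin_RintegralE measurableT ith) -EFinM lee_fin.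
  by rewrite -/J mulVf// gt_eqF.
have [wn [vwn wnL]] := weight_versions mh hL.
have := doob mh (le_lt_trans luxh (ltry _)) vwn.
move=> luxM.
(* The infimum in [lux] need not be attained; doubling the constant makes the inequality strict and
   so provides an admissible [rho]. *)
have : (lux P (conj_fun phi) (maxf wn) < (2 * CM * J)%:E)%E.
  apply: (le_lt_trans luxM); apply: (@le_lt_trans _ _ (CM%:E * J%:E)%E).
    by apply: lee_wpmul2l => //; rewrite lee_fin ltW.
  by rewrite -EFinM lte_fin ltr_pM2r// ltr_pMl// ltr1n.
move=> /lux_lt[rho [rho0 rhoJ irho]].
pose W x := fine (maxf wn x).
have WE x : maxf wn x = (W x)%:E.
  rewrite fineK// ge0_fin_numE ?maxf_ge0// (@le_lt_trans _ _ L%:E) ?ltry//.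
  apply: ge_ereal_sup => _ [n _ <-]; rewrite lee_fin.
  by have /andP[? ?] := wnL n x; rewrite ger0_norm.
have mW : measurable_fun setT W.
  apply/measurable_EFinP; rewrite (_ : _ \o _ = maxf wn); last first.
    by apply/funext => x; rewrite WE.
  apply: (emeasurable_fun_cvg (fun n x => (running_max wn n x)%:E)); last first.
    by move=> x _; exact: cvg_running_max.
  move=> n; apply/measurable_EFinP; apply: (G_meas_measurable (@FT n)).
  by apply: (G_meas_running_max FF) => k; case: (vwn k).
have W0 x : 0 <= W x by rewrite -lee_fin -WE maxf_ge0.
have := dom mh hL wnL vwn.
under [X in (_ <= _ * X)%E]eq_integral do rewrite WE.
have young := integral_young phiMO p1 C0 phi_lower mY Y0 mW W0 lam0 rho0 iY.
have {}young : (\int[P]_x (Y x * (W x)%:E) <= (2 * (lam * rho))%:E)%E.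
  apply: young; under eq_integral do rewrite -WE; exact: irho.
move=> domX.
have : ((mu * J)%:E <= A%:E * (2 * (lam * rho))%:E)%E.
  apply: (@le_trans _ _ (\int[P]_x (X x * (h x)%:E))%E); last first.
    by apply: (le_trans domX); apply: lee_wpmul2l => //; rewrite lee_fin ltW.
  rewrite EFinM /J -(EFin_RintegralE measurableT ith) -integralZl//.
  apply: le_integral_lower => x.
    by rewrite -EFinM lee_fin !mulr_ge0// ltW.
  rewrite /= -EFinM mulrA EFinM; apply: lee_wpmul2r => //.
  by rewrite lee_fin.
rewrite -EFinM lee_fin => muJ.
have rJ : A * (2 * (lam * rho)) <= 4 * A * lam * CM * J.
  rewrite (_ : 4 * A * lam * CM * J = A * (2 * (lam * (2 * CM * J)))); last by ring.
  by rewrite !ler_wpM2l// ltW.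
have := ltr_pM2r J0 (4 * A * lam * CM) mu; rewrite mu_gt.
by rewrite ltNge (le_trans muJ rJ).
Qed.

Let eps := Num.min 1 C^-1.
(** Chosen with [C * sig <= eps], so that [lower_type_linear] gives
    [phi x (sig * r) <= eps * phi x r] for [r >= 0]; the bound [2^-1] ensures [sig < 1]. *)
Let sig := Num.min 2^-1 (eps / C).
Let eps0 : 0 < eps. Proof. by rewrite lt_min ltr01 invr_gt0. Qed.
Let sig0 : 0 < sig. Proof. by rewrite lt_min invr_gt0 ltr0n divr_gt0. Qed.
Let sig1 : sig < 1. Proof. by rewrite gt_min; apply/orP; left; lra. Qed.

(** The truncation level runs through the integers: at each point it eventually exceeds [q x], and
    [t x * q x = eps * phi x (t x)], both sides being 0 where [t x = 0]. *)
Lemma integral_test_limit (t : {nnsfun T >-> R}) (lam mu : R) :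
  0 < lam -> 4 * A * lam * CM < mu ->
  (\int[P]_x Phi_ext (fun x t => (phi x t)%:E) x (`|Y x| * (lam^-1)%:E) <= 1)%E ->
  (forall x, (mu * t x)%:E <= X x)%E ->
  (\int[P]_x (eps * phi x (t x))%:E <= 1)%E.
Proof.
move=> lam0 mu_gt iY tX.
have t0 x : 0 <= t x by [].
have mphit : measurable_fun setT (fun x => phi x (t x)) by exact: measurable_MO_nnsfun phiMO t.
have mt : measurable_fun setT (t : T -> R) by exact: measurable_funPT.
pose q x := eps * phi x (t x) / t x.
have q0 x : 0 <= q x by rewrite divr_ge0// mulr_ge0 ?phi_ge0// ltW.
have mq : measurable_fun setT q.
  apply: measurable_funM; first exact: measurable_funM.
  exact: (measurableT_comp (@measurable_invr R) mt).
apply: (integral_le_sup (g := fun n x => (t x * Num.min (q x) n%:R)%:E)).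
- by move=> n; apply/measurable_EFinP; apply: measurable_funM => //; exact: measurable_minr.
- by move=> n x; rewrite lee_fin mulr_ge0// le_min q0 ler0n.
- by move=> x n m nm; rewrite lee_fin ler_wpM2l// le_min !ge_min lexx/= ler_nat nm orbT.
- by move=> x; rewrite lee_fin mulr_ge0 ?phi_ge0// ltW.
- move=> x; apply: (@le_trans _ _ (t x * q x)%:E).
    rewrite lee_fin /q; have [->|tx] := eqVneq (t x) 0; first by rewrite phi0 mulr0 mul0r.
    by rewrite [leRHS]mulrC divfK.
  apply: ereal_sup_ubound; exists (Num.bound (q x)) => //.
  by rewrite min_l// ltW// archi_boundP.
- by move=> n; apply: integral_test_le1 lam0 mu_gt _ iY tX.
Qed.

(** For every [lam] admissible for [Y], the number [l] below is admissible for [X]: simple functions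
    [t n] increasing to [X / mu] satisfy the test inequality, and [phi x (X x / l)] lies below the
    supremum of [eps * phi x (t n x)]. *)
Lemma luxR_domination :
  (luxR P phi X <= (10 * A * CM / sig)%:E * luxR P phi Y)%E.
Proof.
have K0 : 0 < 10 * A * CM / sig by rewrite divr_gt0// !mulr_gt0.
rewrite -lee_pdivrMl//; apply: le_ereal_inf_tmp => _ [lam [lam0 iY] <-].
rewrite lee_pdivrMl// -EFinM.
(* Any factor above 4 would give the strict inequality required of [mu]. *)
pose mu := 5 * A * lam * CM.
have mu0 : 0 < mu by rewrite !mulr_gt0.
have mu_gt : 4 * A * lam * CM < mu by rewrite /mu !ltr_pM2r// ltr_nat.
(* The factor 2 leaves room: [t n] reaches half of a finite positive limit at some [n], but perhaps
   never the limit itself. The division by [sig] absorbs [eps], and [2 * 5 = 10]. *)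
pose l := 2 * mu / sig.
have l0 : 0 < l by rewrite divr_gt0// mulr_gt0.
apply: ereal_inf_lbound; exists l; last by rewrite /l /mu; congr _%:E; field; rewrite gt_eqF.
split => //.
pose X' x := (X x * (mu^-1)%:E)%E.
have mX' : measurable_fun setT X' by exact: emeasurable_funM.
have X'0 x : (0 <= X' x)%E by rewrite mule_ge0// lee_fin invr_ge0 ltW.
have XX' x : X x = (mu%:E * X' x)%E.
  by rewrite /X' muleCA -EFinM divff ?gt_eqF// mule1.
have [t [ndt tX' tleX']] := nnsfun_approximation mX' X'0.
have t0 n x : 0 <= t n x by [].
apply: (integral_le_sup (g := fun n x => (eps * phi x (t n x))%:E)).
- move=> n; apply/measurable_EFinP; apply: measurable_funM => //.
  exact: measurable_MO_nnsfun phiMO (t n).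
- by move=> n x; rewrite lee_fin mulr_ge0 ?phi_ge0// ltW.
- by move=> x n m nm; rewrite lee_fin ler_wpM2l ?(ltW eps0)// phi_nd// ndt.
- by move=> x; apply: (Phi_ge0 phiMO); rewrite mule_ge0// lee_fin invr_ge0 ltW.
- move=> x; rewrite gee0_abs//.
  have := tX' x; have := X'0 x; have := XX' x; case: (X' x) => [r|//|//].
    move=> -> r0 tr; rewrite -EFinM /=.
    rewrite (_ : mu * r / l = sig * (r / 2)); last by rewrite /l; field; rewrite !gt_eqF.
    rewrite lee_fin in r0.
    have small : phi x (sig * (r / 2)) <= eps * phi x (r / 2).
      have r20 : 0 <= r / 2 by rewrite divr_ge0.
      apply: (le_trans (lower_type_linear phiMO p1 C0 phi_lower x sig0 sig1 r20)).
      rewrite ler_wpM2r ?phi_ge0// -ler_pdivlMl// mulrC.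
      by rewrite ge_min lexx orbT.
    move: r0; rewrite le_eqVlt => /predU1P[<-|r0].
      rewrite mul0r mulr0 phi0; apply: le_ereal_sup_tmp; exists (eps * phi x (t 0%N x))%:E.
        by exists 0%N.
      by rewrite lee_fin mulr_ge0 ?phi_ge0// ltW.
    have [n tn] : exists n, r / 2 <= t n x.
      have /fine_cvgP[_ /cvgr_ge] := tr.
      move=> /(_ (r / 2)) []; first lra.
      by move=> n _ /(_ n (leqnn n)) /= h; exists n.
    apply: le_ereal_sup_tmp; exists (eps * phi x (t n x))%:E; first by exists n.
    rewrite lee_fin (le_trans small)// ler_wpM2l ?(ltW eps0)// phi_nd//.
    by rewrite divr_ge0// ltW.
  (* Where [X] is infinite the left side is infinite, and so is the supremum, because [phi x] tends
     to infinity. *)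
  move=> Xy _ ty; rewrite Xy mulry !gtr0_sg ?invr_gt0// !mul1e mulyr gtr0_sg ?invr_gt0// mul1e/=.
  rewrite leye_eq; apply/eqP/eqyP => B B0.
  have [s sB] : exists s, 0 <= s /\ B / eps <= phi x s.
    case: phiMO => _ [_ /(_ x)/cvgryPge /(_ (B / eps)) [s0 [_ hs]] _ _ _].
    exists (Num.max 0 (s0 + 1)); split; first by rewrite le_max lexx.
    by apply: hs; rewrite lt_max ltrDl ltr01 orbT.
  have [n tn] : exists n, s <= t n x.
    move/cvgeryP/cvgryPge/(_ s) : ty => [n _ /(_ n (leqnn n)) h].
    by exists n.
  apply: le_ereal_sup_tmp; exists (eps * phi x (t n x))%:E; first by exists n.
  case: sB => s0 sB; rewrite lee_fin -ler_pdivrMl// mulrC (le_trans sB)//.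
  exact: phi_nd.
- move=> n; apply: integral_test_limit lam0 mu_gt iY _ => x.
  by rewrite XX' EFinM; apply: lee_wpmul2l => //; rewrite lee_fin ltW.
Qed.

End domination.

(** * Passage from finite horizons to the limit in weighted inequalities *)

Section limits.
Context {d : measure_display} {T : measurableType d} {R : realType}.
Variable P : probability T R.

(** Monotone convergence of [a n * w] on the left; on the right, [b n <= Y] and the running maxima
    of [wn] stay below [maxf wn]. *)
Lemma integral_dominated_lim (X Y : T -> \bar R) (a b : nat -> T -> R)
    (w : T -> R) (wn : nat -> T -> R) (A L : R) :
  0 <= A -> measurable_fun setT w -> (forall x, 0 <= w x <= L) ->
  (forall n, measurable_fun setT (wn n)) -> (forall n x, 0 <= wn n x <= L) ->
  (forall n, P.-integrable setT (EFin \o a n)) ->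
  (forall n, P.-integrable setT (EFin \o b n)) ->
  (forall n x, 0 <= a n x) -> (forall n x, 0 <= b n x) ->
  (forall x, {homo a ^~ x : n m / (n <= m)%N >-> n <= m}) ->
  (forall x, (a n x)%:E @[n --> \oo] --> X x) ->
  (forall n x, ((b n x)%:E <= Y x)%E) -> (forall x, (0 <= X x)%E) ->
  (forall n, \int[P]_x (a n x * w x) <= A * \int[P]_x (b n x * running_max wn n x)) ->
  (\int[P]_x (X x * (w x)%:E) <= A%:E * \int[P]_x (Y x * maxf wn x))%E.
Proof.
move=> A0 mw wL mwn wnL ia ib a0 b0 nda aX bY X0 ab.
have w0 x : 0 <= w x by case/andP: (wL x).
have mE (g : T -> R) : P.-integrable setT (EFin \o g) -> measurable_fun setT g.
  by move=> ig; apply/measurable_EFinP; exact: measurable_int ig.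
have iaw n : P.-integrable setT (EFin \o (fun x => a n x * w x)).
  apply: (integrable_mul_bounded (c := L)) => // x.
  by rewrite ger0_norm//; case/andP: (wL x).
have mv n : measurable_fun setT (running_max wn n).
  elim: n => [|n ih] /=; first exact: measurableT_comp.
  by apply: measurable_maxr => //; exact: measurableT_comp.
have ibv n : P.-integrable setT (EFin \o (fun x => b n x * running_max wn n x)).
  apply: (integrable_mul_bounded (c := L)) => // x.
  rewrite ger0_norm ?running_max_ge0//; apply: running_max_le => k.
  by have /andP[? ?] := wnL k x; rewrite ger0_norm.
apply: (integral_le_sup (g := fun n x => (a n x * w x)%:E)).
- by move=> n; apply/measurable_EFinP; apply: measurable_funM => //; exact: mE.
- by move=> n x; rewrite lee_fin mulr_ge0.
- by move=> x n m nm; rewrite lee_fin ler_wpM2r// nda.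
- by move=> x; rewrite mule_ge0// lee_fin.
- move=> x; apply: cvge_le_sup; under eq_fun do rewrite EFinM.
  by apply: cvgeZr; last exact: aX.
- move=> n; rewrite (EFin_RintegralE measurableT (iaw n)).
  apply: (@le_trans _ _ (A%:E * \int[P]_x (b n x * running_max wn n x)%:E)%E).
    by rewrite (EFin_RintegralE measurableT (ibv n)) -EFinM lee_fin.
  apply: lee_wpmul2l; first by rewrite lee_fin.
  apply: le_integral_lower => x; first by rewrite lee_fin mulr_ge0// running_max_ge0.
  rewrite EFinM; apply: lee_pmul; rewrite ?lee_fin ?running_max_ge0//.
  exact: running_max_le_maxf.
Qed.

End limits.

(** * Equivalence of the Luxemburg norms of square and maximal function *)

Unset Implicit Arguments.
Theorem theorem5p12 (d : measure_display) (T : measurableType d) (R : realType)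
  (P : probability T R) (F : nat -> set (set T)) (phi : T -> R -> R)
  (pm pp : R) :
  filtration F ->
  MO_function P phi ->
  Ainfty P F phi -> Sminus P F phi ->
  unif_lower_type phi pm -> unif_upper_type phi pp ->
  1 < pm -> pm <= pp ->
  doob_bounded P F (conj_fun phi) ->
  exists C : R, 0 < C /\
    forall f : nat -> T -> R, martingale0 P F f ->
      ((C^-1)%:E * luxR P phi (sqf f) <= luxR P phi (maxf f))%E /\
      (luxR P phi (maxf f) <= C%:E * luxR P phi (sqf f))%E.
Proof.
move=> FF phiMO _ _ [C [C0 phi_lower]] _ pm1 _ [CM [CM0 doob]].
pose sig := Num.min 2^-1 (Num.min 1 C^-1 / C).
have sig0 : 0 < sig by rewrite lt_min invr_gt0 ltr0n divr_gt0// lt_min ltr01 invr_gt0.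
(* The constant of [luxR_domination] for [A = 6], which covers both weighted constants, 4 and 6. *)
pose K := 10 * 6 * CM / sig.
have K0 : 0 < K by rewrite divr_gt0// !mulr_gt0.
exists K; split => // f mf.
have FT n : F n `<=` measurable by case: FF.
have Mf n : G_meas (F n) (f n) by case: mf.
have If n : P.-integrable setT (EFin \o f n) by case: mf.
have Im n := integrable_runmax FF n Mf If.
have Is n := integrable_square_fun FF n Mf If.
have mM : measurable_fun setT (maxf f).
  apply: (emeasurable_fun_cvg (fun n x => (running_max f n x)%:E)).
    by move=> n; exact: measurable_int (Im n).
  by move=> x _; exact: cvg_running_max.
have mS : measurable_fun setT (sqf f).
  apply: (emeasurable_fun_cvg (fun n x => (square_fun f n x)%:E)).
    by move=> n; exact: measurable_int (Is n).
  by move=> x _; exact: cvg_square_fun.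
have mwn (w : T -> R) (wn : nat -> T -> R) n :
    cexp_version P (F n) w (wn n) -> measurable_fun setT (wn n).
  by case=> _ /(G_meas_measurable (@FT n)).
split.
- rewrite lee_pdivrMl//.
  apply: (luxR_domination FF phiMO pm1 C0 phi_lower CM0 doob mS mM (sqf_ge0 f) (maxf_ge0 f)) => //.
  move=> w wn L mw wL wnL vwn.
  apply: (@integral_dominated_lim _ _ _ P _ _ (square_fun f) (running_max f) _ _ 6 L) => //.
  + by move=> n; exact: mwn (vwn n).
  + by move=> n x; exact: square_fun_ge0.
  + by move=> n x; exact: running_max_ge0.
  + by move=> x; exact: square_fun_homo.
  + by move=> x; exact: cvg_square_fun.
  + by move=> n x; exact: running_max_le_maxf.
  + by move=> x; exact: sqf_ge0.
  move=> n; apply: (le_trans (weighted_square_le_max FF mf mw wL wnL vwn n)).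
  rewrite ler_wpM2r ?ler_nat// Rintegral_ge0// => x _.
  by rewrite mulr_ge0// running_max_ge0.
- apply: (luxR_domination FF phiMO pm1 C0 phi_lower CM0 doob mM mS (maxf_ge0 f) (sqf_ge0 f)) => //.
  move=> w wn L mw wL wnL vwn.
  apply: (@integral_dominated_lim _ _ _ P _ _ (running_max f) (square_fun f) _ _ 6 L) => //.
  + by move=> n; exact: mwn (vwn n).
  + by move=> n x; exact: running_max_ge0.
  + by move=> n x; exact: square_fun_ge0.
  + by move=> x; exact: running_max_homo.
  + by move=> x; exact: cvg_running_max.
  + move=> n x; apply: (nd_cvge_ge (u := fun n => (square_fun f n x)%:E)).
      by move=> ? ? ?; rewrite lee_fin square_fun_homo.
    exact: cvg_square_fun.
  + by move=> x; exact: maxf_ge0.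
  by move=> n; exact: (weighted_max_le_square FF mf mw wL wnL vwn n).
Qed.
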